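(* Let $X_1,\dots,X_n$ be Polish spaces, $1\le k<n$, and $\mu_\alpha\in\mathcal{P}(X_\alpha)$ for $\alpha\in\mathcal{I}_{nk}$. (a) If $c\in C_L(X,\mu_\alpha)$, then $$\inf_{\pi\in\Pi(\mu_\alpha)}\int_Xc\,d\pi=\sup\Big\{\sum_{\alpha\in\mathcal{I}_{nk}}\int_{X_\alpha}f_\alpha\,d\mu_\alpha:\ f_\alpha\in C_L(X_\alpha,\mu_\alpha),\ \sum_{\alpha\in\mathcal{I}_{nk}}f_\alpha(x_\alpha)\le c(x)\ \forall x\in X\Big\}.$$ (b) If $c\in C_b(X)$, the same equality holds with the supremum taken over $f_\alpha\in C_b(X_\alpha)$. In both cases, if $\Pi(\mu_\alpha)$ is nonempty, the infimum on the left-hand side is attained. (Convention: the infimum over the empty set is $+\infty$.)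
   Context: $X=\prod_{i=1}^nX_i$; $\mathcal{I}_{nk}$ is the family of $k$-element subsets of $\{1,\dots,n\}$; $X_\alpha=\prod_{i\in\alpha}X_i$, $x_\alpha$ is the projection of $x$ onto $X_\alpha$. $\Pi(\mu_\alpha)$ is the set of probability measures $\pi$ on $X$ whose projection onto $X_\alpha$ is $\mu_\alpha$ for every $\alpha\in\mathcal{I}_{nk}$. $C_L(X_\alpha,\mu_\alpha)=C(X_\alpha)\cap L^1(\mu_\alpha)$; $C_L(X,\mu_\alpha)$ is the set of continuous $c:X\to\mathbb{R}$ such that $|c(x)|\le\sum_{\alpha\in\mathcal{I}_{nk}}c_\alpha(x_\alpha)$ for some $c_\alpha\in C_L(X_\alpha,\mu_\alpha)$. $C_b$ denotes bounded continuous functions. *)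

(* Defs.v *)
From HB Require Import structures.
From mathcomp Require Import all_boot all_order all_algebra.
From mathcomp Require Import all_classical all_reals all_analysis.

Set Implicit Arguments.
Unset Strict Implicit.
Unset Printing Implicit Defensive.

Import Order.TTheory GRing.Theory Num.Theory.
Import numFieldNormedType.Exports.
Local Open Scope classical_set_scope.
Local Open Scope ring_scope.

Definition separable_space (T : topologicalType) : Prop :=
  exists D : set T, countable D /\ closure D = setT.

Definition is_metric (R : realType) (T : Type) (d : T -> T -> R) : Prop :=
  [/\ forall x y, d x y = 0 <-> x = y,
      forall x y, d x y = d y x &
      forall x y z, d x z <= d x y + d y z].

Definition metric_induces_topology (R : realType) (T : topologicalType)
  (d : T -> T -> R) : Prop :=
  forall A : set T, open A <->
    (forall x, A x -> exists2 e : R, 0 < e & [set y | d x y < e] `<=` A).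

Definition metric_complete (R : realType) (T : Type) (d : T -> T -> R) : Prop :=
  forall u : nat -> T,
    (forall e : R, 0 < e -> exists N : nat, forall m p : nat,
        (N <= m)%N -> (N <= p)%N -> d (u m) (u p) < e) ->
    exists l : T, forall e : R, 0 < e -> exists N : nat, forall m : nat,
        (N <= m)%N -> d (u m) l < e.

Definition polish (R : realType) (T : topologicalType) : Prop :=
  separable_space T /\
  exists d : T -> T -> R,
    [/\ is_metric d, metric_induces_topology d & metric_complete d].

Definition borel (T : ptopologicalType) := g_sigma_algebraType (@open T).

Definition Xfull (n : nat) (X : 'I_n -> ptopologicalType) :=
  forall i : 'I_n, X i.
HB.instance Definition _ (n : nat) (X : 'I_n -> ptopologicalType) :=
  Topological.copy (Xfull X) (prod_topology X).
HB.instance Definition _ (n : nat) (X : 'I_n -> ptopologicalType) :=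
  Pointed.copy (Xfull X) (forall i : 'I_n, X i).

Definition Xsub (n : nat) (X : 'I_n -> ptopologicalType) (A : {set 'I_n}) :=
  forall j : {i : 'I_n | i \in A}, X (proj1_sig j).
HB.instance Definition _ (n : nat) (X : 'I_n -> ptopologicalType) A :=
  Topological.copy (Xsub X A)
    (prod_topology (fun j : {i : 'I_n | i \in A} => X (proj1_sig j))).
HB.instance Definition _ (n : nat) (X : 'I_n -> ptopologicalType) A :=
  Pointed.copy (Xsub X A)
    (forall j : {i : 'I_n | i \in A}, X (proj1_sig j)).

Definition proj (n : nat) (X : 'I_n -> ptopologicalType) (A : {set 'I_n})
  (x : Xfull X) : Xsub X A := fun j => x (proj1_sig j).
Arguments proj {n X} A x.

Definition Ink (n k : nat) := {A : {set 'I_n} | #|A| == k}.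

Section Transport.
Variables (R : realType) (n k : nat) (X : 'I_n -> ptopologicalType).

Definition Pi_marg
  (mu : forall a : Ink n k, probability (borel (Xsub X (val a))) R) :
  set (probability (borel (Xfull X)) R) :=
  [set pi : probability (borel (Xfull X)) R | forall (a : Ink n k) (B : set (borel (Xsub X (val a)))),
      measurable B -> pi (proj (val a) @^-1` B) = mu a B].

Definition CL (Y : ptopologicalType) (m : probability (borel Y) R)
  (f : Y -> R) : Prop :=
  continuous f /\ m.-integrable setT (fun y : borel Y => (f y)%:E).

Definition Cb (Y : topologicalType) (f : Y -> R) : Prop :=
  continuous f /\ exists M : R, forall y, `|f y| <= M.

Definition CL_full
  (mu : forall a : Ink n k, probability (borel (Xsub X (val a))) R)
  (c : Xfull X -> R) : Prop :=
  continuous c /\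
  exists ca : forall a : Ink n k, Xsub X (val a) -> R,
    (forall a, CL (mu a) (ca a)) /\
    forall x, `|c x| <= \sum_(a : Ink n k) ca a (proj (val a) x).

(* primal value: inf over Pi(mu_alpha) of int c dpi (inf of empty = +oo) *)
Definition primal_value
  (mu : forall a : Ink n k, probability (borel (Xsub X (val a))) R)
  (c : Xfull X -> R) : \bar R :=
  ereal_inf [set (\int[pi]_(x in setT) (c x)%:E)%E | pi in Pi_marg mu].

Definition dual_value
  (mu : forall a : Ink n k, probability (borel (Xsub X (val a))) R)
  (P : forall a : Ink n k, (Xsub X (val a) -> R) -> Prop)
  (c : Xfull X -> R) : \bar R :=
  ereal_sup [set (\sum_(a : Ink n k) \int[mu a]_(y in setT) (f a y)%:E)%E
            | f in [set f : forall a : Ink n k, Xsub X (val a) -> R |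
                      (forall a, P a (f a)) /\
                      forall x : Xfull X,
                        \sum_(a : Ink n k) f a (proj (val a) x) <= c x]].

End Transport.

(* Main.v *)
Require Import Defs.
From HB Require Import structures.
From mathcomp Require Import all_boot all_order all_algebra.
From mathcomp Require Import all_classical all_reals all_analysis measurable_realfun.
From mathcomp Require Import lra.

Set Implicit Arguments.
Unset Strict Implicit.
Unset Printing Implicit Defensive.

Import Order.TTheory GRing.Theory Num.Theory.
Import numFieldNormedType.Exports.
Local Open Scope classical_set_scope.
Local Open Scope ring_scope.

(** Let v be the supremum of the dual problem.  If v is infinite, weak duality
    leaves no admissible measure.  If v is finite, Hahn-Banach gives a linear
    functional L on the functions dominated by sums of potentials such that L is
    positive, takes the prescribed value on every sum of potentials, and satisfies
    L c <= v.  Each marginal is tight, so L is continuous along sequences of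
    bounded continuous functions decreasing to 0; a Daniell-Riesz construction
    then represents L on bounded continuous functions by a probability measure,
    which has the prescribed marginals and integrates c to at most v, hence is
    optimal. *)

(** * Hahn-Banach for sublinear functionals on a subspace *)

(** The sublinear functional is [above_value h], the least value of a sum of potentials lying above
    [h]. It is finite because v is, and any linear functional below it is automatically positive and
    exact on sums of potentials. The obstacle is loss of mass at infinity: the spaces need not be
    locally compact, and a positive functional on bounded continuous functions may be only finitely
    additive. Compact sets of large mass cannot be used directly, since no measure on X exists yet.
    They are replaced by continuous cutoffs of a single coordinate, to which L applies and on which
    it is a marginal integral. Here [1 <= k] enters: every coordinate belongs to some index set. The
    measure represents L only on bounded functions while c may be unbounded, so the bound on the
    integral of c is recovered by truncation. Compatibility of the marginals is never assumed:
    finiteness of v alone produces the measure. Both statements come from one theorem about a class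
    [P] of potentials between [Cb] and [CL]. *)

Definition sublinear_on (R : realType) (V : lmodType R) (W : set V)
  (p : V -> R) : Prop :=
  (forall u v, W u -> W v -> p (u + v) <= p u + p v) /\
  (forall a u, 0 < a -> W u -> p (a *: u) = a * p u).

Definition subspace (R : realType) (V : lmodType R) (W : set V) : Prop :=
  W 0 /\ forall a u v, W u -> W v -> W (a *: u + v).

Section HahnBanach.
Variables (R : realType) (V : lmodType R) (W : set V).
Hypothesis Wsub : subspace W.

Lemma subspaceD u v : W u -> W v -> W (u + v).
Proof. by move=> Wu Wv; rewrite -[u]scale1r; apply: Wsub.2. Qed.

Lemma subspaceZ a u : W u -> W (a *: u).
Proof. by move=> Wu; rewrite -[_ *: _]addr0; apply: Wsub.2 => //; exact: Wsub.1. Qed.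

Lemma subspaceN u : W u -> W (- u).
Proof. by move=> Wu; rewrite -scaleN1r; exact: subspaceZ. Qed.

Lemma sublinear_on_le p : (forall u v, W u -> W v -> p (u + v) <= p u + p v) ->
  (forall a u, 0 < a -> W u -> p (a *: u) <= a * p u) -> sublinear_on W p.
Proof.
move=> pD pZ; split=> // a u a0 Wu; apply/eqP; rewrite eq_le pZ//=.
have := pZ a^-1 (a *: u).
rewrite invr_gt0 scalerA mulVf ?gt_eqF// scale1r => /(_ a0 (subspaceZ a Wu)).
by rewrite ler_pdivlMl.
Qed.

Lemma sublinear0 p : sublinear_on W p -> p 0 = 0.
Proof.
move=> [_ pZ]; have := pZ 2 0 (ltr0Sn _ 1) Wsub.1; rewrite scaler0; lra.
Qed.

Lemma sublinear_opp p u : sublinear_on W p -> W u -> - p (- u) <= p u.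
Proof.
move=> ps Wu; have := ps.1 u (- u) Wu (subspaceN Wu).
rewrite subrr (sublinear0 ps); lra.
Qed.

(* Shifting along u: the result is a sublinear functional below p which equals
   - p u at - u, i.e. is linear along the line spanned by u. *)
Definition shift_inf (p : V -> R) (u h : V) : R :=
  inf [set p (h + t *: u) - t * p u | t in [set t : R | 0 <= t]].

Section Shift.
Variables (p : V -> R) (u : V).
Hypotheses (ps : sublinear_on W p) (Wu : W u).

(** Subadditivity for [t *: u = (h + t *: u) + (- h)]. The bound matters because [inf] takes the
    default value 0 on a set without lower bound. *)
Lemma shift_lb h t : W h -> 0 <= t -> - p (- h) <= p (h + t *: u) - t * p u.
Proof.
move=> Wh; rewrite le_eqVlt => /predU1P[<-|t0].
  by rewrite scale0r addr0 mul0r subr0; exact: sublinear_opp.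
have := ps.1 (h + t *: u) (- h) (subspaceD Wh (subspaceZ t Wu)) (subspaceN Wh).
rewrite addrAC subrr add0r ps.2//; lra.
Qed.

Lemma shift_le h t : W h -> 0 <= t -> shift_inf p u h <= p (h + t *: u) - t * p u.
Proof.
move=> Wh t0; apply: ge_inf; last by exists t.
by exists (- p (- h)) => _ [s s0 <-]; exact: shift_lb.
Qed.

Lemma shift_le0 h : W h -> shift_inf p u h <= p h.
Proof.
by move=> Wh; have := shift_le Wh (lexx 0); rewrite scale0r addr0 mul0r subr0.
Qed.

Lemma shift_ge h y : (forall t, 0 <= t -> y <= p (h + t *: u) - t * p u) ->
  y <= shift_inf p u h.
Proof.
move=> H; apply: lb_le_inf => [|_ [t t0 <-]]; last exact: H.
by exists (p (h + 0 *: u) - 0 * p u), 0 => /=.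
Qed.

Lemma shift_sublinear : sublinear_on W (shift_inf p u).
Proof.
apply: sublinear_on_le => [v w Wv Ww|b w b0 Ww].
  rewrite -lerBlDr; apply: shift_ge => s s0.
  rewrite lerBlDr [leRHS]addrC -lerBlDr.
  apply: shift_ge => t t0.
  have := shift_le (subspaceD Wv Ww) (addr_ge0 s0 t0).
  have := ps.1 (v + s *: u) (w + t *: u)
    (subspaceD Wv (subspaceZ s Wu)) (subspaceD Ww (subspaceZ t Wu)).
  rewrite addrACA -scalerDl; lra.
rewrite -ler_pdivrMl//; apply: shift_ge => t t0.
rewrite ler_pdivrMl//.
have := shift_le (subspaceZ b Ww) (mulr_ge0 (ltW b0) t0).
rewrite -scalerA -scalerDr ps.2//; last exact: subspaceD (subspaceZ _ Wu).
lra.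
Qed.

End Shift.

(** Zorn's lemma. The pointwise infimum of a chain exists because every sublinear [q] below [p]
    satisfies [- p (- u) <= - q (- u) <= q u]. *)
Lemma minimal_sublinear_exists p : sublinear_on W p ->
  exists q, [/\ sublinear_on W q, forall u, W u -> q u <= p u &
    forall r, sublinear_on W r -> (forall u, W u -> r u <= q u) ->
      forall u, W u -> q u <= r u].
Proof.
move=> ps.
pose T := {q : V -> R | sublinear_on W q /\ forall u, W u -> q u <= p u}.
(* The order is reversed, so that a maximal element is a minimal functional. Values outside [W] are
   ignored, which makes this only a preorder. *)
pose le_on (q r : T) := `[< forall u, W u -> sval r u <= sval q u >].
pose p0 : T := exist _ p (conj ps (fun u _ => lexx _)).
have [||A Atot|] := @ZL_preorder T p0 le_on.
- by move=> q; apply/asboolP.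
- move=> r s t /asboolP rs /asboolP st; apply/asboolP => u Wu.
  exact: le_trans (st u Wu) (rs u Wu).
- have [A0|/nonemptyPn A0] := pselect (A !=set0); last first.
    by exists p0 => s; rewrite A0.
  have [q0 Aq0] := A0.
  pose m (u : V) := inf [set sval q u | q in A].
  have m_le q u : W u -> A q -> m u <= sval q u.
    move=> Wu Aq; apply: ge_inf; last by exists q.
    exists (- p (- u)) => _ [r Ar <-].
    apply: le_trans (sublinear_opp (svalP r).1 Wu).
    by rewrite lerN2 (svalP r).2//; exact: subspaceN.
  have m_ge u y : (forall q, A q -> y <= sval q u) -> y <= m u.
    move=> H; apply: lb_le_inf; first by exists (sval q0 u), q0.
    by move=> _ [q Aq <-]; exact: H.
  have ms : sublinear_on W m.
    apply: sublinear_on_le => [u v Wu Wv|b w b0 Ww].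
      rewrite -lerBlDr; apply: (m_ge) => q Aq.
      rewrite lerBlDr [leRHS]addrC -lerBlDr; apply: (m_ge) => r Ar.
      rewrite lerBlDr [leRHS]addrC.
      have Wuv := subspaceD Wu Wv.
      (* The two infima are approached by different members of the chain; the smaller of the two
         serves for both arguments. *)
      have [/asboolP qr|/asboolP rq] := Atot _ _ Aq Ar.
        apply: le_trans (m_le r _ Wuv Ar) _.
        by apply: le_trans ((svalP r).1.1 u v Wu Wv) _; rewrite lerD// qr.
      apply: le_trans (m_le q _ Wuv Aq) _.
      by apply: le_trans ((svalP q).1.1 u v Wu Wv) _; rewrite lerD// rq.
    rewrite -ler_pdivrMl//; apply: (m_ge) => q Aq.
    rewrite ler_pdivrMl// -((svalP q).1.2 b w b0 Ww).
    exact: m_le (subspaceZ b Ww) Aq.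
  have mp u : W u -> m u <= p u.
    by move=> Wu; apply: le_trans (m_le q0 u Wu Aq0) _; exact: (svalP q0).2.
  by exists (exist _ m (conj ms mp)) => s As; apply/asboolP => u Wu; exact: m_le.
move=> [q [qs qp]] qmin; exists q; split=> // r rs rq u Wu.
have rp v : W v -> r v <= p v.
  by move=> Wv; exact: le_trans (rq v Wv) (qp v Wv).
have /asboolP : le_on (exist _ r (conj rs rp)) (exist _ q (conj qs qp)).
  by apply: qmin; apply/asboolP.
exact.
Qed.

(* A minimal sublinear functional agrees with its own shifts, which forces additivity. *)
Lemma hahn_banach p c : sublinear_on W p -> W c ->
  exists L : V -> R, [/\ forall a u v, W u -> W v -> L (a *: u + v) = a * L u + L v,
    forall u, W u -> L u <= p u & p c <= L c].
Proof.
move=> ps Wc.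
(* Minimality is taken below the shift of [p] along [c], not below [p] itself: at [- c] the shift is
   at most [p 0 - p c = - p c], which yields [p c <= q c] at the end. *)
have [q [qs qle qmin]] := minimal_sublinear_exists (shift_sublinear ps Wc).
have qD u v : W u -> W v -> q (u + v) = q u + q v.
  move=> Wu Wv; apply/eqP; rewrite eq_le qs.1//=.
  have := qmin _ (shift_sublinear qs Wv) (fun u Wu => shift_le0 qs Wv Wu) u Wu.
  have := shift_le qs Wv Wu ler01; rewrite scale1r mul1r; lra.
have qN u : W u -> q (- u) = - q u.
  move=> Wu; have := qD u (- u) Wu (subspaceN Wu); rewrite subrr (sublinear0 qs); lra.
have qZ a u : W u -> q (a *: u) = a * q u.
  move=> Wu; have [a0|a0|<-] := ltgtP 0 a.
  - exact: qs.2.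
  - rewrite -[a *: u]opprK -scaleNr qN; last exact: subspaceZ.
    by rewrite qs.2 ?oppr_gt0// mulNr opprK.
  - by rewrite scale0r mul0r (sublinear0 qs).
exists q; split.
- by move=> a u v Wu Wv; rewrite qD ?qZ//; exact: subspaceZ.
- by move=> u Wu; apply: le_trans (qle u Wu) _; exact: shift_le0.
- have WNc := subspaceN Wc.
  have := qle (- c) WNc; have := shift_le ps Wc WNc ler01.
  rewrite scale1r addNr mul1r (sublinear0 ps) qN//; lra.
Qed.

End HahnBanach.

(** * Metric spaces and bounded continuous functions *)

Section Metric.
Variables (R : realType) (T : topologicalType) (d : T -> T -> R).
Hypotheses (dm : is_metric d) (di : metric_induces_topology d).

Lemma metric0 x : d x x = 0.
Proof. by case: dm => d0 _ _; apply/d0. Qed.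

Lemma metricC x y : d x y = d y x.
Proof. by case: dm. Qed.

Lemma metric_triangle x y z : d x z <= d x y + d y z.
Proof. by case: dm. Qed.

Lemma metric_ge0 x y : 0 <= d x y.
Proof.
have := metric_triangle x y x; rewrite metric0 [d y x]metricC; lra.
Qed.

Lemma nbhs_metric x (A : set T) :
  nbhs x A <-> exists2 e : R, 0 < e & [set y | d x y < e] `<=` A.
Proof.
split=> [|[e e0 eA]].
  rewrite nbhsE => -[B [oB Bx] BA]; have [e e0 eB] := (di B).1 oB x Bx.
  by exists e => //; exact: subset_trans BA.
rewrite nbhsE; exists [set y | d x y < e] => //; split; last by rewrite /= metric0.
apply/di => y /= xye; exists (e - d x y); first by rewrite subr_gt0.
by move=> z /= yz; apply: le_lt_trans (metric_triangle x y z) _; rewrite -ltrBrDl.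
Qed.

Lemma lipschitz_continuous (f : T -> R) (k : R) :
  (forall x y, f x - f y <= k * d x y) -> continuous f.
Proof.
move=> fk x; apply/cvgrPdist_lt => e e0.
have k0 : 0 < `|k| + 1 by rewrite ltr_wpDl.
apply/nbhs_metric; exists (e / (`|k| + 1)); first by rewrite divr_gt0.
move=> y /=; rewrite ltr_pdivlMr// => xye.
have := fk x y; have := fk y x; rewrite [d y x]metricC => yx xy.
have : k * d x y <= d x y * (`|k| + 1).
  by rewrite mulrC ler_wpM2l ?metric_ge0// (le_trans (ler_norm _))// lerDl.
rewrite ltr_norml; lra.
Qed.

Lemma continuous_metricl z : continuous (fun x => d x z).
Proof.
apply: (@lipschitz_continuous _ 1) => x y.
by rewrite mul1r lerBlDr metric_triangle.
Qed.

(* Inf-convolution of the indicator of U: these Lipschitz functions increase to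
   the indicator when U is open. *)
Definition bump (U : set T) (j : nat) (x : T) : R :=
  inf [set \1_U z + j%:R * d x z | z in [set: T]].

Let bump_term_ge0 (U : set T) j x z : 0 <= \1_U z + j%:R * d x z.
Proof. by rewrite addr_ge0 ?mulr_ge0 ?metric_ge0. Qed.

Lemma bump_le U j x z : bump U j x <= \1_U z + j%:R * d x z.
Proof. by apply: ge_inf; [exists 0 => _ [w _ <-]|exists z]. Qed.

Lemma bump_ge U j x y : (forall z, y <= \1_U z + j%:R * d x z) -> y <= bump U j x.
Proof.
move=> H; apply: lb_le_inf => [|_ [z _ <-]//].
by exists (\1_U x + j%:R * d x x), x.
Qed.

Lemma bump_ge0 U j x : 0 <= bump U j x.
Proof. exact: bump_ge. Qed.

Lemma bump_le_indic U j x : bump U j x <= \1_U x.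
Proof. by have := bump_le U j x x; rewrite metric0 mulr0 addr0. Qed.

Lemma bump_le1 U j x : bump U j x <= 1.
Proof. by apply: le_trans (bump_le_indic U j x) _; rewrite indicE lern1 leq_b1. Qed.

Lemma bump_homo U x : {homo bump U ^~ x : i j / (i <= j)%N >-> i <= j}.
Proof.
move=> i j ij; apply: bump_ge => z; apply: le_trans (bump_le U i x z) _.
by rewrite lerD2l ler_wpM2r ?metric_ge0// ler_nat.
Qed.

Lemma continuous_bump U j : continuous (bump U j).
Proof.
apply: (@lipschitz_continuous _ j%:R) => x y.
rewrite lerBlDr -lerBlDl; apply: bump_ge => z; rewrite lerBlDl.
apply: le_trans (bump_le U j x z) _.
rewrite addrCA lerD2l -mulrDr ler_wpM2l//; exact: metric_triangle.
Qed.

(** [U] contains a ball of radius [e] around [x]. A point of the ball contributes indicator 1, and a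
    point outside costs at least [j%:R * e], which is at least 1 once [j] exceeds [1 / e]. *)
Lemma bump_near1 (U : set T) x : open U -> U x -> \forall j \near \oo, bump U j x = 1.
Proof.
move=> oU Ux; have [e e0 eU] := (di U).1 oU x Ux.
near=> j; apply/eqP; rewrite eq_le bump_le1; apply: bump_ge => z.
have [xz|xz] := ltP (d x z) e.
  by rewrite indicE mem_set ?lerDl ?mulr_ge0 ?metric_ge0//; exact: eU.
apply: (@le_trans _ _ (j%:R * d x z)); last by rewrite lerDr.
apply: (@le_trans _ _ (j%:R * e)); last by rewrite ler_wpM2l.
rewrite -ler_pdivrMr// div1r; near: j.
exact: nbhs_infty_ger.
Unshelve. all: by end_near. Qed.

Lemma bump_cvg (U : set T) x : open U -> bump U ^~ x @ \oo --> (\1_U x : R).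
Proof.
move=> oU; have [Ux|nUx] := pselect (U x).
  apply: cvg_near_cst; rewrite indicE mem_set//; exact: bump_near1.
rewrite indicE memNset//; apply: cvg_near_cst; apply: nearW => j.
apply/eqP; rewrite eq_le bump_ge0 andbT.
by have := bump_le_indic U j x; rewrite indicE memNset.
Qed.

End Metric.

Section BoundedContinuous.
Variables (R : realType) (T : topologicalType).
Implicit Types f g : T -> R.

Lemma Cb_cst (r : R) : Cb (fun _ : T => r).
Proof. by split; [move=> x; exact: cvg_cst|exists `|r|]. Qed.

Lemma Cb_lin (a : R) f g : Cb f -> Cb g -> Cb (fun x => a * f x + g x).
Proof.
move=> [cf [M fM]] [cg [N gN]]; split.
  by move=> x; apply: cvgD; [apply: cvgMr; exact: cf|exact: cg].
exists (`|a| * M + N) => x; apply: le_trans (ler_normD _ _) _.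
by rewrite lerD// normrM ler_wpM2l.
Qed.

Lemma Cb_min f g : Cb f -> Cb g -> Cb (fun x => Num.min (f x) (g x)).
Proof.
move=> [cf [M fM]] [cg [N gN]]; split.
  by move=> x; apply: (@continuous_min _ _ f g); [exact: cf|exact: cg].
exists (M + N) => x; rewrite minElt; case: ifP => _.
  by rewrite (le_trans (fM x))// lerDl (le_trans _ (gN x)).
by rewrite (le_trans (gN x))// lerDr (le_trans _ (fM x)).
Qed.

Lemma Cb_max f g : Cb f -> Cb g -> Cb (fun x => Num.max (f x) (g x)).
Proof.
move=> [cf [M fM]] [cg [N gN]]; split.
  by move=> x; apply: (@continuous_max _ _ f g); [exact: cf|exact: cg].
exists (M + N) => x; rewrite maxElt; case: ifP => _.
  by rewrite (le_trans (gN x))// lerDr (le_trans _ (fM x)).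
by rewrite (le_trans (fM x))// lerDl (le_trans _ (gN x)).
Qed.

Lemma CbD f g : Cb f -> Cb g -> Cb (fun x => f x + g x).
Proof.
move=> Cf Cg; have := Cb_lin 1 Cf Cg.
by congr Cb; apply/funext => x; rewrite mul1r.
Qed.

Lemma CbZ (a : R) f : Cb f -> Cb (fun x => a * f x).
Proof.
move=> Cf; have := Cb_lin a Cf (Cb_cst 0).
by congr Cb; apply/funext => x; rewrite addr0.
Qed.

Lemma CbB f g : Cb f -> Cb g -> Cb (fun x => f x - g x).
Proof.
move=> Cf Cg; have := Cb_lin (-1) Cg Cf.
by congr Cb; apply/funext => x; rewrite mulN1r addrC.
Qed.

Lemma Cb_sum (I : Type) (s : seq I) (F : I -> T -> R) :
  (forall i, Cb (F i)) -> Cb (fun x => \sum_(i <- s) F i x).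
Proof.
move=> CF; elim: s => [|i s IH].
  by have := Cb_cst 0; congr Cb; apply/funext => x; rewrite big_nil.
have := CbD (CF i) IH.
by congr Cb; apply/funext => x; rewrite big_cons.
Qed.

End BoundedContinuous.

Section BorelIntegral.
Variables (R : realType) (T : ptopologicalType).

Lemma borel_open (U : set T) : open U -> measurable (U : set (borel T)).
Proof. exact: sub_sigma_algebra. Qed.

Lemma continuous_borel_measurable (f : T -> R) (D : set (borel T)) :
  continuous f -> measurable_fun D (f : borel T -> R).
Proof.
move=> cf; apply: (@measurable_funS _ _ _ _ setT) => //.
apply: (measurability _ (measurable_realfun.RGenOpens.measurableE R)).
move=> _ [_ [a [b ->] <-]]; rewrite setTI; apply: borel_open.
by move/continuousP : cf; apply; exact: interval_open.
Qed.

Variable m : probability (borel T) R.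

Lemma Cb_integrable (f : T -> R) :
  Cb f -> m.-integrable setT (fun y : borel T => (f y)%:E).
Proof.
move=> [cf [M fM]]; apply: measurable_bounded_integrable => //.
- exact: fin_num_fun_lty.
- exact: continuous_borel_measurable.
- by exists M; split; [exact: num_real|] => y My x _ /=; rewrite (le_trans (fM x)) ?ltW.
Qed.

End BorelIntegral.

(** * Daniell-Riesz representation *)

Section Riesz.
Variables (R : realType) (T : ptopologicalType) (d : T -> T -> R).
Hypotheses (dm : is_metric d) (di : metric_induces_topology d).
Variable L : (T -> R) -> R.
Hypothesis Llin : forall a f g, Cb f -> Cb g ->
  L (fun x => a * f x + g x) = a * L f + L g.
Hypothesis Lpos : forall f, Cb f -> (forall x, 0 <= f x) -> 0 <= L f.
Hypothesis L1 : L (fun=> 1) = 1.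
Hypothesis Lsmooth : forall h : nat -> T -> R, (forall j, Cb (h j)) ->
  (forall j x, 0 <= h j.+1 x <= h j x) -> (forall x, h ^~ x @ \oo --> (0 : R)) ->
  forall e : R, 0 < e -> exists j, L (h j) < e.

Lemma func0 : L (fun=> 0) = 0.
Proof.
have := Llin 1 (Cb_cst T 0) (Cb_cst T 0).
under eq_fun do rewrite mul1r addr0.
by rewrite mul1r; lra.
Qed.

Lemma funcD f g : Cb f -> Cb g -> L (fun x => f x + g x) = L f + L g.
Proof.
move=> Cf Cg; rewrite -[L f]mul1r -Llin//.
by congr L; apply/funext => x; rewrite mul1r.
Qed.

Lemma funcZ a f : Cb f -> L (fun x => a * f x) = a * L f.
Proof.
move=> Cf; rewrite -[RHS]addr0 -func0 -Llin//; last exact: Cb_cst.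
by congr L; apply/funext => x; rewrite addr0.
Qed.

Lemma funcB f g : Cb f -> Cb g -> L (fun x => f x - g x) = L f - L g.
Proof.
move=> Cf Cg; rewrite -[- L g]mulN1r [RHS]addrC -Llin//.
by congr L; apply/funext => x; rewrite mulN1r addrC.
Qed.

Lemma func_cst r : L (fun=> r) = r.
Proof.
rewrite -[RHS]mulr1 -L1 -funcZ; last exact: Cb_cst.
by congr L; apply/funext => x; rewrite mulr1.
Qed.

Lemma le_func f g : Cb f -> Cb g -> (forall x, f x <= g x) -> L f <= L g.
Proof.
move=> Cf Cg fg; rewrite -subr_ge0 -funcB//; apply: Lpos; first exact: CbB.
by move=> x; rewrite subr_ge0.
Qed.

Lemma func_sum (I : Type) (s : seq I) (F : I -> T -> R) : (forall i, Cb (F i)) ->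
  L (fun x => \sum_(i <- s) F i x) = \sum_(i <- s) L (F i).
Proof.
move=> CF; elim: s => [|i s IH].
  by rewrite big_nil -[RHS]func0; congr L; apply/funext => x; rewrite big_nil.
rewrite big_cons -IH -funcD//; last exact: Cb_sum.
by congr L; apply/funext => x; rewrite big_cons.
Qed.

(** The test functions of Riesz's construction, without compact support: the space need not be
    locally compact, and [Lsmooth] compensates for this. *)
Definition below (U : set T) : set (T -> R) :=
  [set f | Cb f /\ forall x, 0 <= f x <= \1_U x].

Definition open_mass (U : set T) : \bar R :=
  ereal_sup [set (L f)%:E | f in below U].

Definition outer_mass (A : set T) : \bar R :=
  ereal_inf [set open_mass U | U in [set U | open U /\ A `<=` U]].

Lemma below_bump U j : below U (bump d U j).
Proof.
split; last by move=> x; rewrite bump_ge0 ?bump_le_indic.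
split; first exact: continuous_bump.
by exists 1 => x; rewrite ger0_norm ?bump_ge0 ?bump_le1.
Qed.

Lemma below_le1 U f x : below U f -> f x <= 1.
Proof.
by move=> [_ /(_ x)/andP[_ /le_trans]]; apply; rewrite indicE lern1 leq_b1.
Qed.

Lemma below_out U f x : below U f -> ~ U x -> f x = 0.
Proof.
move=> [_ /(_ x)]; rewrite indicE => + Ux; rewrite memNset//= => fx.
by apply/eqP; rewrite eq_le andbC.
Qed.

Lemma open_mass_ub U f : below U f -> ((L f)%:E <= open_mass U)%E.
Proof. by move=> Uf; apply: ereal_sup_ubound; exists f. Qed.

Lemma open_mass_ge0 U : (0 <= open_mass U)%E.
Proof.
have := @open_mass_ub U (fun=> 0); rewrite func0; apply.
by split=> [|x]; [exact: Cb_cst|rewrite lexx indicE ler0n].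
Qed.

Lemma le_open_mass U V : U `<=` V -> (open_mass U <= open_mass V)%E.
Proof.
move=> UV; apply: ereal_sup_le => _ [f [Cf Uf] <-]; exists f => //; split=> // x.
 have /andP[-> /le_trans] /= := Uf x; apply.
rewrite !indicE ler_nat; have [/set_mem xU|//] := boolP (x \in U).
by rewrite mem_set//; exact: UV.
Qed.

Lemma open_massT : open_mass setT = 1%E.
Proof.
apply/eqP; rewrite eq_le; apply/andP; split.
  apply: ge_ereal_sup => _ [f fT <-]; rewrite lee_fin -[leRHS]L1.
  apply: le_func; [exact: fT.1|exact: Cb_cst|move=> x; exact: below_le1 fT].
have := @open_mass_ub setT (fun=> 1); rewrite L1; apply; split; first exact: Cb_cst.
by move=> x; rewrite indicT ler01 lexx.
Qed.

Lemma open_mass_le1 U : (open_mass U <= 1)%E.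
Proof. by rewrite -open_massT; exact: le_open_mass. Qed.

Lemma open_mass0 : open_mass set0 = 0%E.
Proof.
apply/eqP; rewrite eq_le open_mass_ge0 andbT.
apply: ge_ereal_sup => _ [f f0 <-].
rewrite (_ : f = fun=> 0) ?func0//.
by apply/funext => x; exact: below_out f0 _.
Qed.

(** In [g j] the index [j] is both the number of open sets and the steepness of their bumps, so
    [g j] increases and is eventually at least 1 at each point of the union. The positive part of
    [f - g j] thus decreases to 0, and [Lsmooth] makes its mass smaller than [e]. Countable
    additivity rests on this step. *)
Lemma open_mass_bigcup (U : nat -> set T) : (forall i, open (U i)) ->
  (open_mass (\bigcup_i U i) <= \sum_(i <oo) open_mass (U i))%E.
Proof.
move=> oU; apply: ge_ereal_sup => _ [f Uf <-].
apply/lee_addgt0Pr => e e0.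
pose g j x := \sum_(i < j) bump d (U i) j x.
pose h j x := Num.max 0 (f x - g j x).
have Cg j : Cb (g j) by apply: Cb_sum => i; exact: (below_bump _ _).1.
have Ch j : Cb (h j) by apply: Cb_max; [exact: Cb_cst|apply: CbB => //; exact: Uf.1].
have g_homo j x : g j x <= g j.+1 x.
  rewrite /g big_ord_recr/= -[leLHS]addr0 lerD ?bump_ge0//.
  by apply: ler_sum => i _; apply: bump_homo.
have [|x|j Lj] := @Lsmooth h Ch _ _ e e0.
- move=> j x; rewrite le_max lexx/= ge_max le_max lexx/= le_max lerB ?orbT//.
- apply: cvg_near_cst.
  have [[i _ Uix]|nU] := pselect ((\bigcup_i U i) x); last first.
    apply: nearW => j; rewrite /h (below_out Uf nU) sub0r.
    apply/max_idPl; rewrite oppr_le0; apply: sumr_ge0 => i _; exact: bump_ge0.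
  near=> j; rewrite /h; apply/max_idPl; rewrite subr_le0.
  apply: le_trans (below_le1 x Uf) _.
  have ij : (i < j)%N by near: j; exact: nbhs_infty_gt.
  rewrite /g (bigD1 (Ordinal ij))//= -[leLHS]addr0 lerD//.
    by rewrite (_ : bump _ _ _ _ = 1)//; near: j; exact: bump_near1.
  by apply: sumr_ge0 => k _; exact: bump_ge0.
have fgh : L f <= L (g j) + L (h j).
  rewrite -funcD//; apply: le_func; [exact: Uf.1|exact: CbD|move=> x].
  by rewrite -lerBlDl /h le_max lexx orbT.
apply: (@le_trans _ _ (L (g j) + e)%:E).
  by rewrite lee_fin (le_trans fgh)// lerD2l ltW.
rewrite EFinD leeD2r// /g (func_sum _ (F := fun i : 'I_j => bump d (U i) j)); last by move=> i; exact: (below_bump _ _).1.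
rewrite -sumEFin; apply: (@le_trans _ _ (\sum_(i < j) open_mass (U i))%E).
  by apply: lee_sum => i _; apply: open_mass_ub; exact: below_bump.
rewrite -(big_mkord xpredT (fun i => open_mass (U i))).
by apply: nneseries_lim_ge => i _ _; exact: open_mass_ge0.
Unshelve. all: by end_near. Qed.

Lemma outer_mass_open U : open U -> outer_mass U = open_mass U.
Proof.
move=> oU; apply/eqP; rewrite eq_le; apply/andP; split.
  by apply: ereal_inf_lbound; exists U => //; split.
by apply: le_ereal_inf_tmp => _ [V [oV UV] <-]; exact: le_open_mass.
Qed.

Lemma outer_mass_ge0 A : (0 <= outer_mass A)%E.
Proof. by apply: le_ereal_inf_tmp => _ [V _ <-]; exact: open_mass_ge0. Qed.

Lemma outer_mass_le1 A : (outer_mass A <= 1)%E.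
Proof.
rewrite -open_massT; apply: ereal_inf_lbound; exists setT => //; split => //.
exact: openT.
Qed.

Lemma outer_mass_fin A : outer_mass A \is a fin_num.
Proof.
rewrite ge0_fin_numE ?outer_mass_ge0//.
by apply: le_lt_trans (outer_mass_le1 A) _; rewrite ltry.
Qed.

Lemma le_outer_mass : {homo outer_mass : A B / A `<=` B >-> (A <= B)%E}.
Proof.
move=> A B AB; apply: le_ereal_inf_tmp => _ [V [oV BV] <-].
by apply: ereal_inf_lbound; exists V => //; split=> //; exact: subset_trans BV.
Qed.

Lemma outer_mass0 : outer_mass set0 = 0%E.
Proof. by rewrite outer_mass_open ?open_mass0//; exact: open0. Qed.

Lemma outer_mass_sigma_subadditive : sigma_subadditive outer_mass.
Proof.
move=> F; apply/lee_addgt0Pr => e e0.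
apply: le_trans (epsilon_trick _ _ (ltW e0)) => //; last first.
  by move=> n; exact: outer_mass_ge0.
have /choice[U UP] : forall n, exists U, [/\ open U, F n `<=` U &
    (open_mass U <= outer_mass (F n) + (e / (2 ^ n.+1)%:R)%:E)%E].
  move=> n; have eps0 : 0 < e / (2 ^ n.+1)%:R.
    by rewrite divr_gt0// ltr0n expn_gt0.
  have [_ [U [oU FU] <-] Ule] := lb_ereal_inf_adherent eps0 (outer_mass_fin (F n)).
  by exists U; split=> //; exact: ltW.
apply: (@le_trans _ _ (\sum_(i <oo) open_mass (U i))%E); last first.
  apply: lee_nneseries => i *; first exact: open_mass_ge0.
  by case: (UP i).
apply: le_trans (open_mass_bigcup _); last by move=> i; case: (UP i).
apply: ereal_inf_lbound; exists (\bigcup_i U i) => //; split.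
  by apply: bigcup_open => i _; case: (UP i).
by move=> x [i _ Fx]; exists i => //; case: (UP i) => _ + _; apply.
Qed.

HB.instance Definition _ := isOuterMeasure.Build R T outer_mass
  outer_mass0 outer_mass_ge0 le_outer_mass outer_mass_sigma_subadditive.

(** A test function [f] below the indicator of [V] and [U] vanishes on [V] minus [U], but not on a
    neighbourhood of it. Lowering [f] by [e] repairs this at cost [e]: [f'] vanishes where [f < e],
    so on the open set [W], which contains [V] minus [U]. Then [f'] plus any test function below [W]
    is still below [V]. *)
Lemma open_mass_split U V : open U -> open V ->
  (open_mass (V `&` U) + outer_mass (V `&` ~` U) <= open_mass V)%E.
Proof.
move=> oU oV; rewrite -leeBrDr ?outer_mass_fin//.
apply: ge_ereal_sup => _ [f VUf <-]; rewrite leeBrDr ?outer_mass_fin//.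
apply/lee_addgt0Pr => e e0.
have [Cf f01] := VUf.
pose f' x := Num.max 0 (f x - e).
have Cf' : Cb f' by apply: Cb_max; [exact: Cb_cst|apply: CbB => //; exact: Cb_cst].
pose W := [set x | f x < e] `&` V.
have oW : open W.
  apply: openI => //; apply: (@open_comp _ _ f [set r | r < e]); last exact: open_lt.
  by move=> x _; exact: Cf.1.
have VUW : V `&` ~` U `<=` W.
  by move=> x [Vx nUx]; split=> //=; rewrite (below_out VUf)// => -[].
have Lf : L f <= L f' + e.
  rewrite -[X in _ + X](func_cst e) -funcD//; last exact: Cb_cst.
  apply: le_func => //; first by apply: CbD => //; exact: Cb_cst.
  by move=> x; rewrite -lerBlDr /f' le_max lexx orbT.
have WV : (open_mass W <= open_mass V - (L f')%:E)%E.
  apply: ge_ereal_sup => _ [g Wg <-].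
  rewrite leeBrDr// -EFinD; rewrite -funcD//; last exact: Wg.1.
  apply: open_mass_ub; split; first by apply: CbD => //; exact: Wg.1.
  move=> x; have /andP[f0 fVU] := f01 x.
  have /andP[g0 _] := Wg.2 x.
  rewrite addr_ge0//=; last by rewrite /f' le_max lexx.
  have [Vx|nVx] := pselect (V x); last first.
    rewrite (below_out Wg) => [|[]//]; rewrite add0r /f'.
    rewrite (below_out VUf) => [|[]//]; rewrite sub0r max_l; last by rewrite oppr_le0 ltW.
    by rewrite indicE ler0n.
  rewrite indicE mem_set//.
  have [fe|ef] := ltP (f x) e.
    by rewrite /f' max_l ?subr_le0 ?(ltW fe)// addr0 (below_le1 x Wg).
  rewrite (below_out Wg) => [|[/=]]; last by rewrite ltNge ef.
  rewrite add0r /f' ge_max ler01/= lerBlDr (le_trans (below_le1 x VUf))//.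
  by rewrite lerDl ltW.
apply: (@le_trans _ _ ((L f')%:E + e%:E + open_mass W)%E).
  rewrite -EFinD leeD ?lee_fin// -outer_mass_open//; exact: le_outer_mass.
by rewrite addeAC leeD2r// addeC -leeBrDr.
Qed.

Lemma open_caratheodory U : open U -> caratheodory_measurable outer_mass U.
Proof.
move=> oU; apply: le_caratheodory_measurable => A.
apply: le_ereal_inf_tmp => _ [V [oV AV] <-].
apply: le_trans (open_mass_split oU oV).
rewrite leeD//; last by apply: le_outer_mass; exact: setSI.
by rewrite -outer_mass_open; [apply: le_outer_mass; exact: setSI|exact: openI].
Qed.

Lemma borel_caratheodory (A : set (borel T)) : measurable A ->
  caratheodory_measurable outer_mass A.
Proof.
apply: smallest_sub; last by move=> U /open_caratheodory.
exact: (@sigma_algebra_measurable _ (caratheodory_type outer_mass)).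
Qed.

Definition riesz_mass : set (borel T) -> \bar R := outer_mass.

Let riesz_mass0 : riesz_mass set0 = 0%E.
Proof. exact: outer_mass0. Qed.

Let riesz_mass_ge0 A : (0 <= riesz_mass A)%E.
Proof. exact: outer_mass_ge0. Qed.

Let riesz_mass_sigma_additive : semi_sigma_additive riesz_mass.
Proof.
move=> F mF tF mUF.
apply: (@caratheodory_measure_sigma_additive R T outer_mass F) => //.
  by move=> i; exact: borel_caratheodory.
exact: borel_caratheodory.
Qed.

HB.instance Definition _ := isMeasure.Build _ (borel T) R riesz_mass
  riesz_mass0 riesz_mass_ge0 riesz_mass_sigma_additive.

Let riesz_massT : riesz_mass setT = 1%E.
Proof. by rewrite /riesz_mass outer_mass_open ?open_massT//; exact: openT. Qed.

HB.instance Definition _ := Measure_isProbability.Build _ (borel T) R riesz_mass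
  riesz_massT.

Local Notation pi := (riesz_mass : probability (borel T) R).

Let J (f : T -> R) : R := \int[pi]_x f x.

Let JB f g : Cb f -> Cb g -> J (fun x => f x - g x) = J f - J g.
Proof. by move=> Cf Cg; apply: RintegralB => //; exact: Cb_integrable. Qed.

Let le_J f g : Cb f -> Cb g -> (forall x, f x <= g x) -> J f <= J g.
Proof. by move=> Cf Cg fg; apply: le_Rintegral => //; exact: Cb_integrable. Qed.

Let massE U : open U -> ((fine (open_mass U))%:E = pi U)%E.
Proof. by move=> oU; rewrite -outer_mass_open// fineK// outer_mass_fin. Qed.

(* Layer cake: compare f with the truncations min(f, i/n), whose increments are
   squeezed between multiples of the indicators of {f > i/n} and {f > (i+1)/n}. *)
Lemma func_le_integral01 f : Cb f -> (forall x, 0 <= f x <= 1) -> L f <= J f.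
Proof.
move=> Cf f01; apply/ler_addgt0Pr => e e0.
have [n en] : exists n : nat, n.+1%:R^-1 < e.
  have [n _ /(_ n (leqnn n)) ne] := near_infty_natSinv_lt (PosNum e0).
  by exists n.
apply: (@le_trans _ _ (J f + n.+1%:R^-1)); last by rewrite lerD2l ltW.
pose N : R := n.+1%:R; have N0 : 0 < N by rewrite ltr0n.
pose g i x := Num.min (f x) (i%:R / N).
have Cg i : Cb (g i) by apply: Cb_min => //; exact: Cb_cst.
pose U i := [set x | i%:R / N < f x].
have oU i : open (U i).
  apply: (@open_comp _ _ f [set r | i%:R / N < r]); last exact: open_gt.
  by move=> x _; exact: Cf.1.
have iN i : i.+1%:R / N = i%:R / N + N^-1 by rewrite -natr1 mulrDl mul1r.
have NV0 : 0 < N^-1 by rewrite invr_gt0.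
pose a i : R := N^-1 * fine (open_mass (U i)).
have La i : L (g i.+1) - L (g i) <= a i.
  rewrite -funcB// /a mulrC ler_pdivlMr// mulrC -funcZ; last exact: CbB.
  rewrite -lee_fin fineK; last by rewrite -outer_mass_open// outer_mass_fin.
  apply: open_mass_ub; split; first by apply: CbZ; exact: CbB.
  move=> x; rewrite mulr_ge0 ?(ltW N0)//=; last first.
    by rewrite subr_ge0 /g le_min ge_min lexx/= ge_min iN lerDl (ltW NV0) orbT.
  rewrite indicE; have [fx|fx] := ltP (i%:R / N) (f x).
    rewrite mem_set// -ler_pdivlMl// mulr1 lerBlDr addrC {2}/g min_r ?(ltW fx)//.
    by rewrite -iN /g ge_min lexx orbT.
  rewrite memNset /U/=; last by rewrite ltNge fx.
  by rewrite /g !min_l ?subrr ?mulr0// iN (le_trans fx)// lerDl ltW.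
have aJ i : a i.+1 <= J (g i.+1) - J (g i).
  rewrite -JB// -lee_fin /a EFinM massE//.
  have -> : (pi (U i.+1) = \int[pi]_x (\1_(U i.+1) x)%:E)%E.
    by rewrite integral_indic// ?setIT//; exact: borel_open.
  have mU : measurable (U i.+1 : set (borel T)) by exact: borel_open.
  rewrite -ge0_integralZl//; last 2 first.
  - by apply/measurable_EFinP; exact: measurable_indic.
  - by rewrite lee_fin ltW.
  rewrite /J /Rintegral fineK; last first.
    by apply: integrable_fin_num => //; apply: Cb_integrable; exact: CbB.
  apply: ge0_le_integral => //.
  - by move=> x _; rewrite -EFinM lee_fin indicE mulr_ge0 ?ler0n// ltW.
  - by apply: emeasurable_funM => //; apply/measurable_EFinP; exact: measurable_indic.
  - apply/measurable_EFinP; apply: continuous_borel_measurable.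
    by have [] := CbB (Cg i.+1) (Cg i).
  move=> x _; rewrite -EFinM lee_fin indicE.
  have [fx|fx] := ltP (i.+1%:R / N) (f x).
    rewrite mem_set// mulr1 /g !min_r ?(ltW fx)//; last first.
      by rewrite (le_trans _ (ltW fx))// iN lerDl ltW.
    by rewrite iN addrAC subrr add0r.
  rewrite memNset /U/=; last by rewrite ltNge fx.
  rewrite mulr0 subr_ge0 le_min ge_min lexx/= ge_min iN.
  by rewrite lerDl (ltW NV0) orbT.
have a0 : a 0%N <= N^-1.
  rewrite /a -[leRHS]mulr1 ler_wpM2l ?(ltW NV0)// -lee_fin fineK.
    exact: open_mass_le1.
  by rewrite -outer_mass_open// outer_mass_fin.
have g0 : g 0%N = fun=> 0.
  by apply/funext => x; rewrite /g mul0r min_r//; case/andP: (f01 x).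
(* By [La] and [aJ], each increment of [L] is bounded by the increment of [J] one level lower. This
   shift by one level leaves over only the first term [a 0], at most [N^-1]. *)
have LJ i : L (g i.+1) <= J (g i) + N^-1.
  elim: i => [|i IH].
    have -> : J (g 0%N) = 0 by rewrite g0 /J /Rintegral integral0.
    by have := La 0%N; rewrite g0 func0 subr0 add0r => /le_trans; apply.
  have := La i.+1; rewrite lerBlDr => /le_trans; apply.
  have := lerD (aJ i) IH; rewrite addrA => /le_trans; apply.
  by rewrite subrK.
have -> : f = g n.+1.
  by apply/funext => x; rewrite /g divff ?gt_eqF// min_l//; case/andP: (f01 x).
apply: le_trans (LJ n) _; rewrite lerD2r; apply: le_J => // x.
by rewrite /g le_min ge_min lexx/= ge_min iN lerDl (ltW NV0) orbT.
Qed.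

Lemma func_le_integral f : Cb f -> L f <= J f.
Proof.
move=> Cf; have [_ [M0 fM0]] := Cf.
pose M := Num.max M0 1; have M1 : 0 < M by rewrite lt_max ltr01 orbT.
have fM x : - M <= f x <= M.
  by rewrite -ler_norml (le_trans (fM0 x))// le_max lexx.
(* The affine map from [[-M, M]] onto [[0, 1]]. It can be undone on both sides because [L] and [J]
   agree on constants. *)
pose g x := (2 * M)^-1 * f x + 2^-1.
have Cg : Cb g by apply: CbD; [exact: CbZ|exact: Cb_cst].
have gf : (fun x => 2 * M * g x - M) = f.
  apply/funext => x; rewrite /g mulrDr mulrA divff ?mul1r; last first.
    by rewrite gt_eqF// mulr_gt0.
  by rewrite mulrAC divff// mul1r addrK.
have g01 x : 0 <= g x <= 1.
  have /andP[Mf fM'] := fM x.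
  have -> : g x = (2 * M)^-1 * (f x + M).
    rewrite /g mulrDr; congr (_ + _).
    by rewrite invfM divfK// gt_eqF.
  rewrite mulr_ge0 ?invr_ge0 ?mulr_ge0 ?(ltW M1)//=; last by rewrite -lerBlDr sub0r.
  rewrite ler_pdivrMl ?mulr1 ?mulr_gt0//; lra.
have Jg := func_le_integral01 Cg g01.
have CMg := CbZ (2 * M) Cg; have CM := Cb_cst T M.
rewrite -gf JB// funcB// funcZ// func_cst /J RintegralZl//; last exact: Cb_integrable.
rewrite Rintegral_cst//= probability_setT/= mulr1 lerD2r ler_wpM2l//.
by rewrite mulr_ge0 ?ltW.
Qed.

Theorem riesz_representation : exists m : probability (borel T) R,
  forall f, Cb f -> (\int[m]_x (f x)%:E = (L f)%:E)%E.
Proof.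
exists pi => f Cf.
rewrite -[LHS]fineK; last first.
  by apply: integrable_fin_num => //; exact: Cb_integrable.
rewrite -/(Rintegral pi setT f) -/(J f); congr EFin.
apply/eqP; rewrite eq_le func_le_integral// andbT.
(* The reverse inequality is the same lemma applied to [0 - f]. *)
have C0 := Cb_cst T (0 : R); have := func_le_integral (CbB C0 Cf).
by rewrite funcB// JB// func0 /J Rintegral_cst//= mul0r !sub0r lerN2.
Qed.

End Riesz.

(** * Finite products of metric spaces *)

Section ProductMetric.
Variables (R : realType) (I : finType) (K : I -> topologicalType).
Variable d : forall i, K i -> K i -> R.
Hypotheses (dm : forall i, is_metric (@d i))
  (di : forall i, metric_induces_topology (@d i)).

Lemma cvg_prod_topology (F : set_system (prod_topology K)) (f : prod_topology K) :
  Filter F -> (forall i, (fun g : prod_topology K => g i) @ F --> f i) -> F --> f.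
Proof.
move=> FF Ff; apply/cvg_sup => i U [V] [[W oW <-] Wf WU].
apply: filterS WU _; apply: Ff; exact: open_nbhs_nbhs.
Qed.

Definition prod_metric (x y : prod_topology K) : R := \sum_i d (x i) (y i).

Lemma le_prod_metric i x y : d (x i) (y i) <= prod_metric x y.
Proof.
rewrite /prod_metric (bigD1 i)//= lerDl; apply: sumr_ge0 => j _.
exact: metric_ge0.
Qed.

Lemma prod_metric_is_metric : is_metric prod_metric.
Proof.
split=> [x y|x y|x y z].
- split=> [xy|->]; last by rewrite /prod_metric big1// => i _; rewrite metric0.
  apply: functional_extensionality_dep => i; have [d0 _ _] := dm i; apply/d0.
  apply/eqP; rewrite eq_le metric_ge0// andbT -xy; exact: le_prod_metric.
- by apply: eq_bigr => i _; rewrite metricC.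
- by rewrite -big_split/=; apply: ler_sum => i _; exact: metric_triangle.
Qed.

Lemma prod_metric_induces : metric_induces_topology prod_metric.
Proof.
move=> A; split=> [oA x Ax|H].
  (* The filter of balls around [x] converges to [x] in each coordinate, hence in the product
     topology. An open set around [x] therefore belongs to it, that is, contains a ball. *)
  pose F := filter_from [set e : R | 0 < e] (fun e => [set y | prod_metric x y < e]).
  have FF : Filter F.
    apply: filter_from_filter; first by exists 1 => /=.
    move=> a b /= a0 b0; exists (Num.min a b); first by rewrite /= lt_min a0.
    by move=> y /=; rewrite lt_min => /andP[].
  have Fx : F --> (x : prod_topology K).
    apply: cvg_prod_topology => i B /(nbhs_metric (dm i) (@di i))[e e0 eB].
    exists e => // y /= xy; apply: eB => /=; exact: le_lt_trans (le_prod_metric i x y) xy.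
  have [e e0 eA] : F A by apply: Fx; exact: open_nbhs_nbhs.
  by exists e.
rewrite openE => x /H[e e0 eA].
pose n1 : R := #|I|.+1%:R; have n0 : 0 < n1 by rewrite ltr0n.
apply: (@filterS _ _ _ [set y : prod_topology K | forall i, d (x i) (y i) < e / n1]).
  move=> y /= xy; apply: eA => /=.
  apply: (@le_lt_trans _ _ (\sum_(i : I) e / n1)).
    by apply: ler_sum => i _; exact: ltW.
  rewrite sumr_const -mulr_natr -mulrA gtr_pMr//.
  by rewrite ltr_pdivrMl// mulr1 ltr_nat.
have := @filter_forall _ I (fun i => [set y : prod_topology K | d (x i) (y i) < e / n1]) _
  (nbhs_filter (x : prod_topology K)); apply => i.
apply: (@function_spaces.proj_continuous I K i x [set z | d (x i) z < e / n1]).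
by apply/(nbhs_metric (dm i) (@di i)); exists (e / n1) => //; rewrite divr_gt0.
Qed.

End ProductMetric.

(** * Ultrafilters and continuous cutoffs in a complete separable metric space *)

Lemma ultra_finite_cover (S : Type) (F : set_system S) (n : nat) (A : nat -> set S) :
  UltraFilter F -> F (\bigcup_(i < n) A i) -> exists2 i, (i < n)%N & F (A i).
Proof.
move=> FU FA; apply: contrapT => /forall2NP nA.
have FC : F (\bigcap_(i < n) ~` A i).
  elim: n {FA} nA => [|n IH] nA; first by apply: filterS filterT => s _ i.
  have IHn : F (\bigcap_(i < n) ~` A i).
    by apply: IH => i; case: (nA i); [move=> H; left; apply: contra_not H => /ltnW|right].
  have [/negP|nFAn] := nA n; first by rewrite ltnSn.
  have [//|FnA] := in_ultra_setVsetC (A n) FU.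
  apply: filterS (filterI IHn FnA) => s [H1 H2] i /=.
  by rewrite ltnS leq_eqVlt => /predU1P[->//|]; exact: H1.
have [s [[i ilt Ais] nAs]] := filter_ex (filterI FA FC).
exact: nAs Ais.
Qed.

Section Tightness.
Variables (R : realType) (T : ptopologicalType) (d : T -> T -> R).
Hypotheses (dm : is_metric d) (di : metric_induces_topology d)
  (dc : metric_complete d).
Variable c : nat -> T.
Hypothesis c_dense : forall x (e : R), 0 < e -> exists j, d x (c j) < e.

(* Vanishes within distance 1/(l+1) of some c j with j < N, and is smaller than 1
   only within distance 2/(l+1) of such a point. *)
Definition far (l N : nat) (x : T) : R :=
  \prod_(j < N) Num.min 1 (Num.max 0 (l.+1%:R * d x (c j) - 1)).

Let factor01 l j x :
  0 <= Num.min 1 (Num.max 0 (l.+1%:R * d x (c j) - 1)) <= (1 : R).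
Proof. by rewrite le_min ge_min lexx ler01 le_max lexx. Qed.

Lemma far01 l N x : 0 <= far l N x <= 1.
Proof.
apply/andP; split; first by apply: prodr_ge0 => j _; case/andP: (factor01 l j x).
apply: (@le_trans _ _ (\prod_(j < N) (1 : R))); last by rewrite big1_eq.
by apply: ler_prod => j _; exact: factor01.
Qed.

Lemma Cb_far l N : Cb (far l N).
Proof.
split; last by exists 1 => x; have /andP[f0 f1] := far01 l N x; rewrite ger0_norm.
elim: N => [|N IH].
  rewrite (_ : far l 0 = fun=> 1); first by move=> x; exact: cvg_cst.
  by apply/funext => x; rewrite /far big_ord0.
pose g x := Num.min 1 (Num.max 0 (l.+1%:R * d x (c N) - 1)).
rewrite (_ : far l N.+1 = fun x => far l N x * g x); last first.
  by apply/funext => x; rewrite /far big_ord_recr.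
move=> x; apply: cvgM; first exact: IH.
have : {for x, continuous ((fun=> 1) \min ((fun=> 0) \max (fun z => l.+1%:R * d z (c N) - 1)))}.
  apply: continuous_min; first exact: cvg_cst.
  apply: continuous_max; first exact: cvg_cst.
  apply: cvgB; last exact: cvg_cst.
  by apply: cvgMr; exact: (continuous_metricl dm di).
exact.
Qed.

Lemma far_cvg0 l x : far l ^~ x @ \oo --> (0 : R).
Proof.
have l0 : 0 < (l.+1%:R^-1 : R) by rewrite invr_gt0 ltr0n.
have [j xj] := c_dense x l0.
apply: cvg_near_cst; near=> N.
have jN : (j < N)%N by near: N; exact: nbhs_infty_gt.
rewrite /far (bigD1 (Ordinal jN))//= (max_l (x := 0)) ?min_r ?mul0r//.
by rewrite subr_le0 -ler_pdivlMl ?ltr0n// mulr1 ltW.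
Unshelve. all: by end_near. Qed.

Lemma far_lt1 l N x : far l N x < 1 ->
  exists2 j, (j < N)%N & d x (c j) < 2 / l.+1%:R.
Proof.
move=> fx; apply: contrapT => /forall2NP nj.
move: fx; rewrite /far big1 ?ltxx// => j _.
apply/min_idPl; rewrite le_max; apply/orP; right.
rewrite lerBrDr -ler_pdivrMl ?ltr0n// mulrC leNgt.
by have [/negP|/negP//] := nj j; rewrite ltn_ord.
Qed.

(** Total boundedness and completeness in ultrafilter form. For each [l], finitely many balls of
    radius [2 / l.+1%:R] contain [F]-almost all [y s], so the ultrafilter selects one centre
    [c (j l)]. Any two selected balls share some [y s]; hence the centres form a Cauchy sequence,
    whose limit is also the limit of [y]. *)
Lemma far_lt1_cvg (N : nat -> nat) (F : set_system nat) (y : nat -> T) :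
  UltraFilter F -> (forall l, \forall s \near F, far l (N l) (y s) < 1) ->
  exists p : T, y @ F --> p.
Proof.
move=> FU Fy.
have /choice[j Fj] : forall l, exists j, F [set s | d (y s) (c j) < 2 / l.+1%:R].
  move=> l; have [] := @ultra_finite_cover _ F (N l)
    (fun j => [set s | d (y s) (c j) < 2 / l.+1%:R]) FU; last by move=> j _; exists j.
  by apply: filterS (Fy l) => s /far_lt1[j jN]; exists j.
have inv_small (e : R) : 0 < e -> exists l0 : nat, forall l, (l0 <= l)%N ->
    2 / l.+1%:R < e.
  move=> e0; have e20 : 0 < e / 2 by rewrite divr_gt0.
  have [l0 _ l0P] := near_infty_natSinv_lt (PosNum e20).
  by exists l0 => l /l0P ll; rewrite -ltr_pdivlMl// mulrC.
have [|p cp] := @dc (fun l => c (j l)).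
  move=> e e0; have e20 : 0 < e / 2 by rewrite divr_gt0.
  have [l0 l0P] := inv_small _ e20; exists l0 => m q ml ql.
  have [s [ms qs]] := filter_ex (filterI (Fj m) (Fj q)).
  apply: le_lt_trans (metric_triangle dm _ (y s) _) _.
  rewrite [e]splitr ltrD// ?(metricC dm (c _)); last exact: lt_trans qs (l0P q ql).
  exact: lt_trans ms (l0P m ml).
exists p => B /(nbhs_metric dm di)[e e0 eB].
have e20 : 0 < e / 2 by rewrite divr_gt0.
have [l0 l0P] := inv_small _ e20; have [l1 l1P] := cp _ e20.
pose l := maxn l0 l1; change (F (y @^-1` B)).
apply: filterS (Fj l) => s /= ys; apply: eB => /=; rewrite (metricC dm).
apply: le_lt_trans (metric_triangle dm _ (c (j l)) _) _.
rewrite [e]splitr ltrD//; last by apply: l1P; exact: leq_maxr.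
by apply: lt_trans ys _; apply: l0P; exact: leq_maxl.
Qed.

End Tightness.

(** * Borel measures and projections *)

Section BorelMaps.
Variables (R : realType).

Lemma continuous_borel_map (T U : ptopologicalType) (f : T -> U) :
  continuous f -> measurable_fun setT (f : borel T -> borel U).
Proof.
move=> /continuousP cf; apply: (measurability _ (erefl : open.-sigma.-measurable = _)).
by move=> _ [V oV <-]; rewrite setTI; apply: borel_open; exact: cf.
Qed.

(** Open sets generate the Borel sets and are stable under intersection, so agreement on them
    suffices. The mass of an open set is the monotone limit of the integrals of its bumps, which are
    bounded and continuous. *)
Lemma borel_measure_ext (T : ptopologicalType) (d : T -> T -> R)
    (m1 m2 : {measure set (borel T) -> \bar R}) :
  is_metric d -> metric_induces_topology d -> (m1 setT < +oo)%E ->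
  (forall f, Cb f -> (\int[m1]_x (f x)%:E = \int[m2]_x (f x)%:E)%E) ->
  forall B : set (borel T), measurable B -> m1 B = m2 B.
Proof.
move=> dm di m1oo m12.
apply: (@g_sigma_algebra_measure_unique _ R (borel T) open _ (fun=> setT)) => //.
- exact: borel_open.
- by move=> _; exact: openT.
- by rewrite -subTset => x _; exists 0%N.
- by move=> U V; exact: openI.
move=> U oU.
have bump_int (m : {measure set (borel T) -> \bar R}) :
    (\int[m]_x (bump d U j x)%:E)%E @[j --> \oo] --> m U.
  have -> : (m U = \int[m]_x (\1_U x)%:E)%E.
    by rewrite integral_indic ?setIT//; exact: borel_open.
  have -> : (\int[m]_x (\1_U x)%:E = \int[m]_x limn (fun j => (bump d U j x)%:E))%E.
    apply: eq_integral => x _; apply/esym/cvg_lim => //.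
    by apply: cvg_EFin; [exact: nearW|exact: bump_cvg].
  apply: (@cvg_monotone_convergence _ _ _ m setT _ (fun j x => (bump d U j x)%:E)) => //.
  - move=> j; apply/measurable_EFinP; apply: continuous_borel_measurable.
    exact: continuous_bump.
  - by move=> j x _; rewrite lee_fin bump_ge0.
  - by move=> x _ i j ij; rewrite lee_fin; exact: bump_homo.
have Cbump j : Cb (bump d U j).
  split; first exact: continuous_bump.
  by exists 1 => x; rewrite ger0_norm ?bump_ge0 ?bump_le1.
have := bump_int m1; under eq_fun do rewrite m12//.
by move/cvg_unique; apply => //; exact: bump_int.
Qed.

End BorelMaps.

Section Projections.
Variables (R : realType) (n k : nat) (X : 'I_n -> ptopologicalType).

Lemma continuous_coord i : continuous (fun x : Xfull X => x i).
Proof. by move=> x; exact: (@function_spaces.proj_continuous 'I_n X i x). Qed.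

Lemma continuous_subcoord (A : {set 'I_n}) (j : {i : 'I_n | i \in A}) :
  continuous (fun y : Xsub X A => y j).
Proof.
move=> y.
exact: (@function_spaces.proj_continuous {i | i \in A} (fun j => X (proj1_sig j)) j y).
Qed.

Lemma continuous_proj (A : {set 'I_n}) : continuous (@Defs.proj n X A).
Proof.
move=> x; apply: (@cvg_prod_topology {i | i \in A} (fun j => X (proj1_sig j))) => j.
exact: continuous_coord.
Qed.

Variable mu : forall a : Ink n k, probability (borel (Xsub X (val a))) R.

Lemma marginal_integral (pi : probability (borel (Xfull X)) R) (a : Ink n k)
    (f : Xsub X (val a) -> R) : Pi_marg mu pi -> CL (mu a) f ->
  pi.-integrable setT (fun x : borel (Xfull X) => (f (Defs.proj (val a) x))%:E) /\
  (\int[pi]_x (f (Defs.proj (val a) x))%:E = \int[mu a]_y (f y)%:E)%E.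
Proof.
move=> pimu [cf fi].
pose phi : borel (Xfull X) -> borel (Xsub X (val a)) := Defs.proj (val a).
have mphi : measurable_fun setT phi by apply: continuous_borel_map; exact: continuous_proj.
have mf : measurable_fun setT (fun y : borel (Xsub X (val a)) => (f y)%:E).
  by apply/measurable_EFinP; exact: continuous_borel_measurable.
have push A : measurable A -> pushforward pi phi A = mu a A by exact: pimu.
have fpi : pi.-integrable setT (fun x : borel (Xfull X) => (f (phi x))%:E).
  apply/integrableP; split.
    by apply: (measurableT_comp mf).
  have /integrableP[_] := fi; apply: le_lt_trans.
  rewrite -(@ge0_integral_pushforward _ _ _ _ R phi mphi pi setT
    (fun y => `|(f y)%:E|%E))//; last by apply: measurableT_comp.
  rewrite (@eq_measure_integral _ _ _ setT (mu a))// => A mA _; exact: push.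
split=> //.
rewrite -(@integral_pushforward _ _ _ _ R phi mphi pi setT (fun y => (f y)%:E))//.
by rewrite (@eq_measure_integral _ _ _ setT (mu a))// => A mA _; exact: push.
Qed.

End Projections.

(** * Tightness *)

(** A functional substitute for Ulam's tightness theorem. The set where [u l (N l) < 1] for all [l]
    plays the role of a compact set, the last clause being its compactness along ultrafilters. The
    pointwise limit allows [N l] to be chosen so that the cutoff has small integral. Continuous
    functions are used instead of sets so that a functional can be applied to them. *)
Definition tight_cutoffs (R : realType) (T : topologicalType)
  (u : nat -> nat -> T -> R) : Prop :=
  [/\ forall l N, Cb (u l N), forall l N x, 0 <= u l N x <= 1,
    forall l x, u l ^~ x @ \oo --> (0 : R) &
    forall (N : nat -> nat) (F : set_system nat) (y : nat -> T), UltraFilter F ->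
      (forall l, \forall s \near F, u l (N l) (y s) < 1) ->
      exists p : T, y @ F --> p].

Lemma polish_tight_cutoffs (R : realType) (T : ptopologicalType) :
  polish R T -> exists u : nat -> nat -> T -> R, tight_cutoffs u.
Proof.
move=> [[D [cD clD]] [d [dm di dc]]].
have D0 : D !=set0.
  have : closure D point by rewrite clD.
  by move=> /(_ setT)[|x [Dx _]]; [exact: filterT|exists x].
have [c cP] : exists c : nat -> T, forall x, D x -> exists j, c j = x.
  move/pfcard_geP : cD => [D0'|/unsquash g]; first by move: D0; rewrite D0' => -[].
  by exists g => x /('surj_g)[j _ gj]; exists j.
have c_dense x (e : R) : 0 < e -> exists j, d x (c j) < e.
  move=> e0; have : closure D x by rewrite clD.
  move=> /(_ [set y | d x y < e])[|y [/cP[j <-] xy]]; last by exists j.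
  by apply/(nbhs_metric dm di); exists e.
exists (far d c); split.
- exact: Cb_far.
- exact: far01.
- exact: far_cvg0.
- exact: far_lt1_cvg.
Qed.

(* A noncompact Dini theorem: if the bound failed for every j, the cutoffs would be
   smaller than 1 along an ultrafilter of counterexamples, which therefore converges. *)
Lemma dini_cutoffs (R : realType) (n : nat) (X : 'I_n -> ptopologicalType)
    (u : forall i, nat -> nat -> X i -> R) (N : 'I_n -> nat -> nat)
    (h : nat -> Xfull X -> R) (M e : R) :
  (forall i, tight_cutoffs (u i)) ->
  (forall j, continuous (h j)) -> (forall j x, h j.+1 x <= h j x) ->
  (forall j x, h j x <= M) -> 0 <= M ->
  (forall x, h ^~ x @ \oo --> (0 : R)) -> 0 < e ->
  exists j, forall x,
    h j x <= e + M * \sum_(i < n) \sum_(l < j) u i l (N i l) (x i).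
Proof.
move=> ut hc hdecr hM M0 h0 e0; apply: contrapT => /forallNP nj.
have /choice[x xP] : forall j, exists x,
    e + M * \sum_(i < n) \sum_(l < j) u i l (N i l) (x i) < h j x.
  by move=> j; have /existsNP[x /negP] := nj j; rewrite -ltNge; exists x.
have [F [FU Foo]] := ultraFilterLemma (@eventually_filter : ProperFilter \oo).
have u0 i l y : 0 <= u i l (N i l) y.
  by have [_ /(_ l (N i l) y)/andP[]] := ut i.
(* For [s > l] this cutoff is a term of the sum in [xP s]. Were it at least 1, the left side there
   would be at least [e + M], above the bound [M] on [h]. *)
have ult i l : \forall s \near F, u i l (N i l) (x s i) < 1.
  apply: Foo; near=> s; rewrite ltNge; apply/negP => u1.
  have ls : (l < s)%N by near: s; exact: nbhs_infty_gt.
  have := lt_le_trans (xP s) (hM s (x s)); apply/negP; rewrite -leNgt.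
  rewrite -[leLHS]add0r lerD ?(ltW e0)// -[leLHS]mulr1 ler_wpM2l//.
  rewrite (bigD1 i)//= (bigD1 (Ordinal ls))//= -addrA -[leLHS]addr0 lerD//.
  by rewrite addr_ge0// ?sumr_ge0// => *; rewrite sumr_ge0.
have pex i : exists p : X i, (fun s => x s i) @ F --> p.
  by have [_ _ _] := ut i; apply.
pose p i := sval (cid (pex i)); have pP i : (fun s => x s i) @ F --> p i := svalP (cid (pex i)).
have xp : x @ F --> (p : Xfull X).
  by apply: (@cvg_prod_topology 'I_n X) => i; exact: pP.
have [j hj] : exists j, h j p < e.
  have /cvgrPdist_lt /(_ e e0)[j _ /(_ j (leqnn j))] := h0 p.
  by rewrite sub0r normrN => /(le_lt_trans (ler_norm _)) ?; exists j.
have hF : F (x @^-1` [set y | h j y < e]).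
  apply: xp; apply: (hc j p [set r | r < e]).
  by apply: open_nbhs_nbhs; split=> //; exact: open_lt.
have jF : F [set s | (j <= s)%N] by apply: Foo; exact: nbhs_infty_ge.
have [s [/= hs js]] := filter_ex (filterI hF jF).
(* Continuity controls only the fixed function [h j] near [p]; monotonicity carries the bound over
   to the diagonal [h s (x s)]. *)
have hh : h s (x s) <= h j (x s).
  elim: s js {hs} (x s) => [|s IH]; first by rewrite leqn0 => /eqP->.
  rewrite leq_eqVlt => /predU1P[->//|js] y.
  exact: le_trans (hdecr s y) (IH js y).
have := lt_trans (lt_le_trans (xP s) hh) hs; apply/negP; rewrite -leNgt lerDl.
by rewrite mulr_ge0// sumr_ge0// => *; rewrite sumr_ge0.
Unshelve. all: by end_near. Qed.

Lemma bounded_integral_small (R : realType) (T : ptopologicalType)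
    (m : probability (borel T) R) (f : nat -> T -> R) (e : R) :
  (forall j, continuous (f j)) -> (forall j x, 0 <= f j x <= 1) ->
  (forall x, f ^~ x @ \oo --> (0 : R)) -> 0 < e ->
  exists j, \int[m]_(y in [set: borel T]) f j y < e.
Proof.
move=> cf f01 f0 e0.
have Cf j : Cb (f j).
  by split=> //; exists 1 => x; have /andP[? ?] := f01 j x; rewrite ger0_norm.
have : (\int[m]_x (f j x)%:E)%E @[j --> \oo] --> (\int[m]_(x in [set: borel T]) (0%R)%:E)%E.
  apply: (@dominated_cvg _ (borel T) R m setT measurableT
    (fun j x => (f j x)%:E) (fun=> (0%R)%:E) (fun=> (1%R)%:E)) => //.
  - by move=> j; apply/measurable_EFinP; exact: continuous_borel_measurable.
  - by move=> x _; apply: cvg_EFin; [exact: nearW|exact: f0].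
  - by apply: Cb_integrable; exact: Cb_cst.
  - move=> j x _; rewrite lee_fin; have /andP[? ?] := f01 j x; by rewrite ger0_norm.
rewrite integral0 => /fine_cvgP[_ /cvgrPdist_lt/(_ e e0)[j _ /(_ j (leqnn j))]].
by rewrite /= sub0r normrN => /(le_lt_trans (ler_norm _)) ?; exists j.
Qed.

Lemma sum_halves_lt (R : realType) (e : R) m : 0 < e ->
  \sum_(l < m) e / (2 ^+ l.+1) < e.
Proof.
move=> e0; suff -> : \sum_(l < m) e / (2 ^+ l.+1) = e - e / 2 ^+ m.
  by rewrite gtrBl divr_gt0// exprn_gt0.
elim: m => [|m IH]; first by rewrite big_ord0 expr0 divr1 subrr.
rewrite big_ord_recr/= IH exprS invfM mulrA; lra.
Qed.

(** * Duality *)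

Lemma subset_card_mem (n k : nat) (i : 'I_n) :
  (1 <= k)%N -> (k < n)%N -> exists a : Ink n k, i \in val a.
Proof.
(* With [i] moved to the front of the enumeration, the first [k] entries contain it as soon as [k]
   is positive. *)
move=> k1 kn; pose s := i :: rem i (enum 'I_n).
have us : uniq s.
  by rewrite /s /= rem_uniq ?enum_uniq// mem_rem_uniq ?enum_uniq// !inE eqxx.
have ss : size s = n.
  rewrite /s /= size_rem ?mem_enum// size_enum_ord prednK//.
  exact: leq_ltn_trans kn.
pose A := [set x in take k s].
have cA : #|A| == k.
  rewrite cardsE (card_uniqP _) ?take_uniq// size_takel// ss; exact: ltnW.
exists (exist _ A cA); rewrite /= inE /s.
by case: k k1 {kn A cA} => // k _; rewrite /= mem_head.
Qed.

Section Duality.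
Variables (R : realType) (n k : nat) (X : 'I_n -> ptopologicalType).
Variable mu : forall a : Ink n k, probability (borel (Xsub X (val a))) R.
(** An abstract class between [Cb] and [CL], closed under linear combinations and absolute value.
    The two cases of the theorem are its two extremes. *)
Variable P : forall a : Ink n k, (Xsub X (val a) -> R) -> Prop.
Arguments P : clear implicits.
Hypotheses (P_CL : forall a f, P a f -> CL (mu a) f)
  (Cb_P : forall a f, Cb f -> P a f)
  (P_lin : forall a r f g, P a f -> P a g -> P a (fun y => r * f y + g y))
  (P_abs : forall a f, P a f -> P a (fun y => `|f y|)).

Definition potentials := forall a : Ink n k, Xsub X (val a) -> R.

Definition potentials_in (F : potentials) : Prop := forall a, P a (F a).

Definition potential_sum (F : potentials) (x : Xfull X) : R :=
  \sum_(a : Ink n k) F a (Defs.proj (val a) x).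

Definition potential_value (F : potentials) : R :=
  \sum_(a : Ink n k) \int[mu a]_(y in [set: borel (Xsub X (val a))]) F a y.

Local Notation lin r F G := (fun a y => r * F a y + G a y).

Lemma potentials_lin r F G : potentials_in F -> potentials_in G ->
  potentials_in (lin r F G).
Proof. by move=> PF PG a; exact: P_lin. Qed.

Lemma potential_sum_lin r F G x :
  potential_sum (lin r F G) x = r * potential_sum F x + potential_sum G x.
Proof. by rewrite /potential_sum mulr_sumr -big_split. Qed.

Lemma potential_value_lin r F G : potentials_in F -> potentials_in G ->
  potential_value (lin r F G) = r * potential_value F + potential_value G.
Proof.
move=> PF PG; rewrite /potential_value mulr_sumr -big_split/=.
apply: eq_bigr => a _.
have [_ iF] := P_CL (PF a); have [_ iG] := P_CL (PG a).
rewrite RintegralD// ?RintegralZl//.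
by have := integrableZl measurableT r iF; apply.
Qed.

Lemma potentials0 : potentials_in (fun a y => 0).
Proof. by move=> a; apply: Cb_P; exact: Cb_cst. Qed.

Lemma potential_sum0 x : potential_sum (fun a y => 0) x = 0.
Proof. by rewrite /potential_sum big1. Qed.

Lemma potential_value0 : potential_value (fun a y => 0) = 0.
Proof. by rewrite /potential_value big1// => a _; rewrite /Rintegral integral0. Qed.

Lemma potentialZ r F : potentials_in F -> exists G, [/\ potentials_in G,
  forall x, potential_sum G x = r * potential_sum F x &
  potential_value G = r * potential_value F].
Proof.
move=> PF; have P0 := potentials0.
exists (lin r F (fun a y => 0)); split; first exact: potentials_lin.
- by move=> x; rewrite potential_sum_lin potential_sum0 addr0.
- by rewrite potential_value_lin// potential_value0 addr0.
Qed.

Lemma potentialD F G : potentials_in F -> potentials_in G ->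
  exists H, [/\ potentials_in H,
  forall x, potential_sum H x = potential_sum F x + potential_sum G x &
  potential_value H = potential_value F + potential_value G].
Proof.
move=> PF PG; exists (lin 1 F G); split; first exact: potentials_lin.
- by move=> x; rewrite potential_sum_lin mul1r.
- by rewrite potential_value_lin// mul1r.
Qed.

Lemma single_potential a0 f : P a0 f -> exists F, [/\ potentials_in F,
  forall x, potential_sum F x = f (Defs.proj (val a0) x) &
  potential_value F = \int[mu a0]_(y in [set: borel (Xsub X (val a0))]) f y].
Proof.
move=> Pf; pose F : potentials := fun a =>
  match pselect (a0 = a) with
  | left e => eq_rect a0 (fun a => Xsub X (val a) -> R) f a e
  | right _ => fun=> 0
  end.
have Fa0 : F a0 = f.
  by rewrite /F; case: pselect => // e; rewrite (Prop_irrelevance e erefl).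
have Fa a : a != a0 -> F a = fun=> 0.
  by move=> aa0; rewrite /F; case: pselect => // e; have := negP aa0; case; apply/eqP/esym.
exists F; split.
- move=> a; have [->|/Fa->] := eqVneq a a0; first by rewrite Fa0.
  exact: potentials0.
- move=> x; rewrite /potential_sum (bigD1 a0)//= Fa0 big1 ?addr0// => a /Fa->.
  by [].
- rewrite /potential_value (bigD1 a0)//= Fa0 big1 ?addr0// => a /Fa->.
  by rewrite /Rintegral integral0.
Qed.

Definition dominated : set (Xfull X -> R^o) :=
  [set h | exists F, potentials_in F /\ forall x, `|h x| <= potential_sum F x].

Definition above (h : Xfull X -> R) : set potentials :=
  [set F | potentials_in F /\ forall x, h x <= potential_sum F x].

(** A superhedging price. It is the dual problem with its sign reversed: potentials below [c] are
    the negatives of potentials above [- c]. *)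
Definition above_value (h : Xfull X -> R^o) : R :=
  inf [set potential_value F | F in above h].

Lemma dominated_subspace : subspace dominated.
Proof.
split.
  exists (fun a y => 0); split; first exact: potentials0.
  by move=> x; rewrite potential_sum0 normr0.
move=> r u v [F [PF uF]] [G [PG vG]]; exists (lin `|r| F G).
split; first exact: potentials_lin.
move=> x; rewrite potential_sum_lin; apply: le_trans (ler_normD _ _) _.
by rewrite lerD// normrM ler_wpM2l.
Qed.

Lemma above_nonempty h : dominated h -> [set potential_value F | F in above h] !=set0.
Proof.
move=> [F [PF hF]]; exists (potential_value F); exists F => //; split=> // x.
exact: le_trans (ler_norm _) (hF x).
Qed.

Lemma dominated_potential F : potentials_in F -> dominated (potential_sum F).
Proof.
move=> PF; exists (fun a y => `|F a y|); split; first by move=> a; exact: P_abs.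
by move=> x; exact: ler_norm_sum.
Qed.

Lemma potential_valueE F : potentials_in F ->
  (\sum_(a : Ink n k) \int[mu a]_(y in setT) (F a y)%:E = (potential_value F)%:E)%E.
Proof.
move=> PF; rewrite -sumEFin; apply: eq_bigr => a _; rewrite /Rintegral fineK//.
by apply: integrable_fin_num => //; have [] := P_CL (PF a).
Qed.

Lemma continuous_potential_sum F : potentials_in F -> continuous (potential_sum F).
Proof.
move=> PF; rewrite /potential_sum; elim: (index_enum _) => [|a s IH].
  by under eq_fun do rewrite big_nil; move=> x; exact: cvg_cst.
under eq_fun do rewrite big_cons; move=> x; apply: cvgD; last exact: IH.
apply: (@continuous_comp _ _ _ (@Defs.proj n X (val a)) (F a)).
  exact: continuous_proj.
by have [cF _] := P_CL (PF a); exact: cF.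
Qed.

Lemma potential_integral pi F : Pi_marg mu pi -> potentials_in F ->
  pi.-integrable setT (fun x : borel (Xfull X) => (potential_sum F x)%:E) /\
  (\int[pi]_x (potential_sum F x)%:E = (potential_value F)%:E)%E.
Proof.
move=> pimu PF; rewrite /potential_sum.
have H a := marginal_integral pimu (P_CL (PF a)).
under eq_fun do rewrite -sumEFin.
split; first by apply: integrable_sum => // a _; have [] := H a.
rewrite integral_sum//; last by move=> a; have [] := H a.
rewrite -potential_valueE//; apply: eq_bigr => a _; by have [] := H a.
Qed.

Lemma dominated_integrable pi c : Pi_marg mu pi -> continuous c -> dominated c ->
  pi.-integrable setT (fun x : borel (Xfull X) => (c x)%:E).
Proof.
move=> pimu cc [F [PF cF]]; have [iF _] := potential_integral pimu PF.
apply: le_integrable iF => //.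
  by apply/measurable_EFinP; exact: continuous_borel_measurable.
by move=> x _; rewrite lee_fin (le_trans (cF x))// ler_norm.
Qed.

Lemma weak_duality pi c F : Pi_marg mu pi -> continuous c -> dominated c ->
  potentials_in F -> (forall x, potential_sum F x <= c x) ->
  ((potential_value F)%:E <= \int[pi]_x (c x)%:E)%E.
Proof.
move=> pimu cc cdom PF Fc; have [iF <-] := potential_integral pimu PF.
apply: le_integral => //; first exact: dominated_integrable.
by move=> x _; rewrite lee_fin.
Qed.

(** * The functional and its representing measure when the dual value is finite *)

Section Functional.
Variables (c : Xfull X -> R) (v : R).
Hypothesis cdom : dominated c.
Hypothesis c_below : forall F, potentials_in F ->
  (forall x, potential_sum F x <= c x) -> potential_value F <= v.

Lemma above_opp_ge F : above (fun x => - c x) F -> - v <= potential_value F.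
Proof.
move=> [PF cF]; have [G [PG GF VG]] := potentialZ (-1) PF.
rewrite lerNl -mulN1r -VG; apply: c_below => // x.
by rewrite GF mulN1r lerNl.
Qed.

(** Finiteness of the dual value enters here. Fix [G] above [- c - h]; for every [F] above [h] the
    sum of the two lies above [- c], so its value is at least [- v]. *)
Lemma above_bounded h : dominated h ->
  has_lbound [set potential_value F | F in above h].
Proof.
move=> hdom; have sub := dominated_subspace.
have : dominated (fun x => - c x - h x).
  have := subspaceD sub (subspaceN sub cdom) (subspaceN sub hdom).
  by congr dominated.
move=> /above_nonempty[_ [G [PG chG] _]].
exists (- v - potential_value G) => _ [F [PF hF] <-].
have [H [PH HFG VH]] := potentialD PF PG.
rewrite lerBlDr -VH; apply: above_opp_ge; split=> // x.
by rewrite HFG; have := chG x; have := hF x; lra.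
Qed.

Lemma above_value_le h F : dominated h -> above h F -> above_value h <= potential_value F.
Proof. by move=> hdom hF; apply: ge_inf; [exact: above_bounded|exists F]. Qed.

Lemma above_value_ge h y : dominated h ->
  (forall F, above h F -> y <= potential_value F) -> y <= above_value h.
Proof.
move=> hdom H; apply: lb_le_inf; first exact: above_nonempty.
by move=> _ [F hF <-]; exact: H.
Qed.

Lemma above_value_sublinear : sublinear_on dominated above_value.
Proof.
have sub := dominated_subspace.
apply: (sublinear_on_le sub) => [f g fdom gdom|r f r0 fdom].
  rewrite -lerBlDr; apply: above_value_ge => // F [PF fF].
  rewrite lerBlDr [leRHS]addrC -lerBlDr; apply: above_value_ge => // G [PG gG].
  rewrite lerBlDr [leRHS]addrC; have [H [PH HFG <-]] := potentialD PF PG.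
  apply: above_value_le; first exact: subspaceD.
  by split=> // x; rewrite HFG lerD.
rewrite -ler_pdivrMl//; apply: above_value_ge => // F [PF fF].
rewrite ler_pdivrMl//; have [G [PG GF <-]] := potentialZ r PF.
apply: above_value_le; first exact: subspaceZ.
by split=> // x; rewrite GF ler_pM2l.
Qed.

(** Everything follows from [L <= above_value]. Comparing at [F] and at its negative gives the exact
    value on sums of potentials. For [f >= 0] the zero potential lies above [- f], so
    [L (- f) <= 0]. Hahn-Banach is applied at [- c], where [above_value] is at least [- v]; this
    gives [L c <= v]. *)
Lemma functional_exists : exists L : (Xfull X -> R) -> R,
  [/\ forall r f g, dominated f -> dominated g ->
        L (fun x => r * f x + g x) = r * L f + L g,
      forall F, potentials_in F -> L (potential_sum F) = potential_value F,
      forall f, dominated f -> (forall x, 0 <= f x) -> 0 <= L f &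
      L c <= v].
Proof.
have sub := dominated_subspace.
have [L [Llin Lp Lc]] := hahn_banach sub above_value_sublinear (subspaceN sub cdom).
have LN f : dominated f -> L (- f) = - L f.
  move=> fdom; have := Llin (-1) f f fdom fdom; have := Llin 0 f (- f) fdom (subspaceN sub fdom).
  have -> : (0 *: f + - f : Xfull X -> R^o) = - f by rewrite scale0r add0r.
  have := Llin 1 f (- f) fdom (subspaceN sub fdom).
  have := Llin 1 0 0 sub.1 sub.1.
  by rewrite !scale1r addr0 subrr; lra.
have le_value F : potentials_in F -> L (potential_sum F) <= potential_value F.
  move=> PF; have Fdom := dominated_potential PF.
  apply: le_trans (Lp _ Fdom) _; exact: above_value_le.
exists L; split.
- exact: Llin.
- move=> F PF; apply/eqP; rewrite eq_le le_value//=.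
  have [G [PG GF VG]] := potentialZ (-1) PF.
  have := le_value _ PG; rewrite VG mulN1r lerNr.
  have -> : potential_sum G = - potential_sum F.
    by apply/funext => x; rewrite GF mulN1r.
  by rewrite LN ?opprK//; exact: dominated_potential.
- move=> f fdom f0; rewrite -oppr_le0 -LN//.
  apply: le_trans (Lp _ (subspaceN sub fdom)) _.
  rewrite -potential_value0; apply: above_value_le; first exact: subspaceN.
  split=> [|x]; first exact: potentials0.
  by rewrite potential_sum0 oppr_le0.
- rewrite -lerN2 -LN//; apply: le_trans Lc.
  by apply: above_value_ge; [exact: subspaceN|exact: above_opp_ge].
Qed.

Hypotheses (Xpolish : forall i, polish R (X i)) (k_ge1 : (1 <= k)%N) (k_ltn : (k < n)%N).

Let coord_in i : exists a : Ink n k, i \in val a.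
Proof. exact: subset_card_mem. Qed.

Let i0 : 'I_n := Ordinal (leq_ltn_trans (leq0n k) k_ltn).

Lemma Cb_dominated f : Cb f -> dominated f.
Proof.
move=> [_ [M fM]]; have [a _] := coord_in i0.
have [F [PF FM _]] := single_potential (Cb_P (Cb_cst (Xsub X (val a)) M)).
by exists F; split=> // x; rewrite FM.
Qed.

Lemma coord_metrics : exists d : forall i, X i -> X i -> R,
  (forall i, is_metric (d i)) /\ (forall i, metric_induces_topology (d i)).
Proof.
have dex i : exists d : X i -> X i -> R, is_metric d /\ metric_induces_topology d.
  by have [_ [d [dm di _]]] := Xpolish i; exists d.
by exists (fun i => sval (cid (dex i))); split=> i; case: (svalP (cid (dex i))).
Qed.

Section Measure.
Variable L : (Xfull X -> R) -> R.
Hypothesis Llin : forall r f g, dominated f -> dominated g ->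
  L (fun x => r * f x + g x) = r * L f + L g.
Hypothesis Lvalue : forall F, potentials_in F -> L (potential_sum F) = potential_value F.
Hypothesis Lpos : forall f, dominated f -> (forall x, 0 <= f x) -> 0 <= L f.

Lemma func_marginal a (f : Xsub X (val a) -> R) : P a f ->
  L (fun x => f (Defs.proj (val a) x)) = \int[mu a]_(y in [set: borel (Xsub X (val a))]) f y.
Proof.
move=> Pf; have [F [PF Ff <-]] := single_potential Pf; rewrite -Lvalue//.
by congr L; apply/funext.
Qed.

Let Llin_Cb r (f g : Xfull X -> R) : Cb f -> Cb g ->
  L (fun x => r * f x + g x) = r * L f + L g.
Proof. by move=> /Cb_dominated fd /Cb_dominated; exact: Llin. Qed.

Let Lpos_Cb f : Cb f -> (forall x, 0 <= f x) -> 0 <= L f.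
Proof. by move=> /Cb_dominated; exact: Lpos. Qed.

Let L1 : L (fun=> 1) = 1.
Proof.
have [a _] := coord_in i0.
have := func_marginal (Cb_P (Cb_cst (Xsub X (val a)) 1)).
by rewrite Rintegral_cst//= probability_setT/= mulr1.
Qed.

(** The Dini estimate bounds [h j] by [e / 2] plus [M] times a finite sum of cutoffs. Each cutoff
    depends on one coordinate, hence is a potential on some [Xsub X (val a)], and [L] of it is an
    integral against [mu a], made small by dominated convergence. *)
Lemma functional_smooth (h : nat -> Xfull X -> R) : (forall j, Cb (h j)) ->
  (forall j x, 0 <= h j.+1 x <= h j x) -> (forall x, h ^~ x @ \oo --> (0 : R)) ->
  forall e : R, 0 < e -> exists j, L (h j) < e.
Proof.
move=> Ch hdecr h0 e e0.
have [_ [M h0M]] := Ch 0%N.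
have M0 : 0 <= M := le_trans (normr_ge0 _) (h0M point).
have hM j x : h j x <= M.
  elim: j => [|j IH]; first exact: le_trans (ler_norm _) (h0M x).
  by apply: le_trans IH; case/andP: (hdecr j x).
pose u i := sval (cid (polish_tight_cutoffs (Xpolish i))).
have ut i : tight_cutoffs (u i) := svalP (cid (polish_tight_cutoffs (Xpolish i))).
have Mn0 : 0 < M * n%:R + 1 by rewrite ltr_wpDl// mulr_ge0.
(* Each of the [n] coordinates contributes a geometric sum below [eps], so the cutoffs cost at most
   [M * n%:R * eps]. The added 1 keeps the denominator positive when [M = 0] and makes this cost
   strictly less than [e / 2]. *)
pose eps := e / 2 / (M * n%:R + 1).
have eps0 : 0 < eps by rewrite !divr_gt0.
have Cu i l N : Cb (fun x : Xfull X => u i l N (x i)).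
  have [Cul _ _ _] := ut i; have [cul [B ulB]] := Cul l N.
  split; last by exists B.
  by move=> x; apply: (@continuous_comp _ _ _ (fun x : Xfull X => x i) (u i l N));
    [exact: continuous_coord|exact: cul].
have uN i l : exists N, L (fun x => u i l N (x i)) < eps / 2 ^+ l.+1.
  have [a ia] := coord_in i; have [Cul ul01 ul0 _] := ut i.
  pose g N (y : Xsub X (val a)) := u i l N (y (exist _ i ia)).
  have cg N : continuous (g N).
    move=> y; apply: (@continuous_comp _ _ _ (fun y : Xsub X (val a) => y (exist _ i ia))
      (u i l N)); [exact: continuous_subcoord|exact: (Cul l N).1].
  have [||||N gN] := @bounded_integral_small R _ (mu a) g (eps / 2 ^+ l.+1).
  - exact: cg.
  - by move=> N y; exact: ul01.
  - by move=> y; exact: ul0.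
  - by rewrite divr_gt0// exprn_gt0.
  exists N; rewrite -(func_marginal (a := a) (f := g N)) in gN => //.
  apply: Cb_P; split; first exact: cg.
  by have [_ [B ulB]] := Cul l N; exists B => y; exact: ulB.
pose N i l := sval (cid (uN i l)).
have NP i l : L (fun x => u i l (N i l) (x i)) < eps / 2 ^+ l.+1 := svalP (cid (uN i l)).
have e20 : 0 < e / 2 by rewrite divr_gt0.
have [||||||j hj] := @dini_cutoffs R n X u N h M (e / 2) ut => //.
- by move=> j; exact: (Ch j).1.
- by move=> j x; case/andP: (hdecr j x).
exists j.
pose s i (x : Xfull X) := \sum_(l < j) u i l (N i l) (x i).
have Cs i : Cb (s i) by apply: Cb_sum => l; exact: Cu.
have CS : Cb (fun x => \sum_(i < n) s i x) by exact: Cb_sum.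
have CMS := CbZ M CS; have Ce := Cb_cst (Xfull X) (e / 2).
apply: (@le_lt_trans _ _ (L (fun x => e / 2 + M * \sum_(i < n) s i x))).
  apply: (le_func Llin_Cb Lpos_Cb) => //; exact: CbD.
rewrite (funcD Llin_Cb)// (func_cst Llin_Cb L1) (funcZ Llin_Cb)// (func_sum Llin_Cb)//.
rewrite [ltRHS]splitr ltrD2l.
apply: (@le_lt_trans _ _ (M * (n%:R * eps))).
  rewrite ler_wpM2l// -[n in n%:R]card_ord -sum1_card natr_sum mulr_suml.
  apply: ler_sum => i _; rewrite mul1r /s (func_sum Llin_Cb); last by move=> l; exact: Cu.
  apply: le_trans (ltW (sum_halves_lt j eps0)).
  by apply: ler_sum => l _; exact: ltW.
by rewrite /eps mulrA [X in X < _]mulrA ltr_pdivrMr// mulrC ltr_pM2l// ltrDl.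
Qed.

Lemma functional_measure : exists pi : probability (borel (Xfull X)) R,
  forall f, Cb f -> (\int[pi]_x (f x)%:E = (L f)%:E)%E.
Proof.
have [d [dm di]] := coord_metrics.
apply: (@riesz_representation R (Xfull X) (@prod_metric R 'I_n X d)) => //.
- exact: prod_metric_is_metric.
- exact: prod_metric_induces.
- exact: functional_smooth.
Qed.

(** The image of [pi] under the projection and [mu a] both integrate a bounded continuous [f] to the
    value of [L] at [f] composed with the projection, so they agree on Borel sets. *)
Lemma functional_measure_marginals (pi : probability (borel (Xfull X)) R) :
  (forall f, Cb f -> (\int[pi]_x (f x)%:E = (L f)%:E)%E) -> Pi_marg mu pi.
Proof.
move=> piL a.
have [d [dm di]] := coord_metrics.
pose dA (j : {i | i \in val a}) := d (proj1_sig j).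
pose phi : borel (Xfull X) -> borel (Xsub X (val a)) := Defs.proj (val a).
have mphi : measurable_fun setT phi by apply: continuous_borel_map; exact: continuous_proj.
have [m1 m1E] : exists m1 : {measure set (borel (Xsub X (val a))) -> \bar R},
    m1 = pushforward pi phi :> (_ -> _).
  by unshelve eexists (pushforward pi phi).
move=> B mB; rewrite -[LHS]/(pushforward pi phi _) -m1E; move: B mB.
apply: (@borel_measure_ext R (Xsub X (val a))
  (@prod_metric R {i | i \in val a} (fun j => X (proj1_sig j)) dA) m1 (mu a)).
- by apply: prod_metric_is_metric => j; exact: dm.
- by apply: prod_metric_induces => j; [exact: dm|exact: di].
- by rewrite m1E /pushforward preimage_setT probability_setT ltry.
move=> f Cf.
have [cf [B fB]] := Cf.
have Cfphi : Cb (fun x : Xfull X => f (Defs.proj (val a) x)).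
  split; last by exists B => x; exact: fB.
  by move=> x; apply: (@continuous_comp _ _ _ (@Defs.proj n X (val a)) f);
    [exact: continuous_proj|exact: cf].
rewrite m1E (@integral_pushforward _ _ _ _ R phi mphi pi setT (fun y => (f y)%:E))//=.
- rewrite piL// func_marginal; last exact: Cb_P.
  by rewrite /Rintegral fineK//; apply: integrable_fin_num => //; exact: Cb_integrable.
- by apply/measurable_EFinP; exact: continuous_borel_measurable.
- exact: Cb_integrable Cfphi.
Qed.

End Measure.

(** Adding a sum of potentials [g] that dominates the absolute value of [c] makes [c + g]
    nonnegative. Its truncations are bounded, so [pi] integrates them to their value under [L], at
    most [L c + L g]. Monotone convergence passes to [c + g], and [g] is then subtracted: its
    integral is finite and fixed by the marginals. *)
Lemma attaining_measure : continuous c ->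
  exists2 pi, Pi_marg mu pi & (\int[pi]_x (c x)%:E <= v%:E)%E.
Proof.
move=> cc; have [L [Llin Lvalue Lpos Lc]] := functional_exists.
have [pi piL] := functional_measure Llin Lvalue Lpos.
have pimu := functional_measure_marginals Lvalue piL.
exists pi => //.
have [G [PG cG]] := cdom; pose g := potential_sum G.
have cg x : 0 <= c x + g x.
  by rewrite -lerBlDl sub0r (le_trans _ (cG x))// -normrN ler_norm.
have [ig vg] := potential_integral pimu PG.
have ic := dominated_integrable pimu cc cdom.
have ccg : continuous (fun x => c x + g x).
  by move=> x; apply: cvgD; [exact: cc|exact: continuous_potential_sum].
pose f N x := Num.min (c x + g x) N%:R.
have Cf N : Cb (f N).
  split.
    have : continuous ((fun x => c x + g x) \min (fun=> N%:R)).
      by move=> x; apply: continuous_min; [exact: ccg|exact: cvg_cst].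
    exact.
  by exists N%:R => x; rewrite ger0_norm ?ge_min ?lexx ?orbT// le_min cg ler0n.
have cgdom : dominated (fun x => 1 * c x + g x).
  by apply: dominated_subspace.2 => //; exact: dominated_potential.
have Lf N : L (f N) <= v + potential_value G.
  apply: (@le_trans _ _ (L (fun x => 1 * c x + g x))); last first.
    by rewrite Llin// ?mul1r ?Lvalue ?lerD2r//; exact: dominated_potential.
  rewrite -subr_ge0 -[- L _]mulN1r addrC -Llin//; last exact: Cb_dominated.
  apply: Lpos.
    by apply: dominated_subspace.2 => //; exact: Cb_dominated.
  by move=> x; rewrite mulN1r addrC subr_ge0 mul1r /f ge_min lexx.
have cgle : (\int[pi]_x (c x + g x)%:E <= (v + potential_value G)%:E)%E.
  have -> : (\int[pi]_x (c x + g x)%:E = \int[pi]_x limn (fun N => (f N x)%:E))%E.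
    apply: eq_integral => x _; apply/esym/cvg_lim => //.
    apply: cvg_near_cst; have [N NP] : exists N : nat, c x + g x <= N%:R.
      by exists (Num.bound (c x + g x)); apply/ltW/archi_boundP.
    near=> m; rewrite /f min_l//; apply: le_trans NP _; rewrite ler_nat.
    by near: m; exact: nbhs_infty_ge.
  have mf N : measurable_fun setT (fun x : borel (Xfull X) => (f N x)%:E).
    by apply/measurable_EFinP; apply: continuous_borel_measurable; exact: (Cf N).1.
  have f0 N (x : borel (Xfull X)) : [set: borel (Xfull X)] x -> (0 <= (f N x)%:E)%E.
    by move=> _; rewrite lee_fin le_min cg ler0n.
  have ndf (x : borel (Xfull X)) : [set: borel (Xfull X)] x ->
      nondecreasing_seq (fun N => (f N x)%:E).
    move=> _ i j ij; rewrite lee_fin /f le_min ge_min lexx/= ge_min ler_nat ij.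
    by rewrite orbT.
  apply: (@cvge_to_le _ _ _ _ _ _ _
    (@cvg_monotone_convergence _ _ R pi setT measurableT _ mf f0 ndf)).
  by apply: nearW => N; rewrite piL// lee_fin.
have : (\int[pi]_x (c x + g x)%:E = \int[pi]_x (c x)%:E + \int[pi]_x (g x)%:E)%E.
  by under eq_integral do rewrite EFinD; rewrite integralD.
by rewrite vg => cgE; move: cgle; rewrite cgE EFinD leeD2rE.
Unshelve. all: by end_near. Qed.

End Functional.

Theorem duality_in_class (c : Xfull X -> R) :
  (forall i, polish R (X i)) -> (1 <= k)%N -> (k < n)%N ->
  continuous c -> dominated c ->
  primal_value mu c = dual_value mu P c /\
  ((exists pi, Pi_marg mu pi) ->
     exists2 pi, Pi_marg mu pi & (\int[pi]_(x in setT) (c x)%:E)%E = primal_value mu c).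
Proof.
move=> Xpolish k1 kn cc cdom.
have weak pi : Pi_marg mu pi -> (dual_value mu P c <= \int[pi]_x (c x)%:E)%E.
  move=> pimu; apply: ge_ereal_sup => _ [F [PF Fc] <-].
  by rewrite potential_valueE//; exact: weak_duality.
have weak_primal : (dual_value mu P c <= primal_value mu c)%E.
  by apply: le_ereal_inf_tmp => _ [pi pimu <-]; exact: weak.
have dual_ge F : potentials_in F -> (forall x, potential_sum F x <= c x) ->
    ((potential_value F)%:E <= dual_value mu P c)%E.
  move=> PF Fc; rewrite -potential_valueE//.
  by apply: ereal_sup_ubound; exists F.
case E : (dual_value mu P c) => [v| |].
- have [|pi pimu piv] := @attaining_measure c v cdom _ Xpolish k1 kn cc.
    by move=> F PF Fc; rewrite -lee_fin -E; exact: dual_ge.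
  have piE : (\int[pi]_x (c x)%:E = v%:E)%E.
    by apply/eqP; rewrite eq_le piv -E weak.
  have primalE : primal_value mu c = v%:E.
    apply/eqP; rewrite eq_le -{2}E weak_primal andbT -piE.
    by apply: ereal_inf_lbound; exists pi.
  by split=> // _; exists pi => //; rewrite piE.
(* Dual value [+oo]: an admissible measure would integrate [c] to [+oo], although a dominated
   continuous function is integrable. *)
- have nopi pi : ~ Pi_marg mu pi.
    move=> pimu; have := weak pi pimu; rewrite E leye_eq => /eqP H.
    have := dominated_integrable pimu cc cdom.
    by move/(integrable_fin_num measurableT); rewrite H.
  split; last by move=> [pi /nopi].
  by apply/eqP; move: weak_primal; rewrite E leye_eq.
(* Dual value [-oo] is impossible: the negative of a sum of potentials dominating the absolute value
   of [c] is a competitor with finite value. *)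
- have [F [PF cF]] := cdom; have [G [PG GF _]] := potentialZ (-1) PF.
  have := dual_ge G PG; rewrite E leeNy_eq => H.
  suff // : (potential_value G)%:E == -oo%E by [].
  apply: H => x; rewrite GF mulN1r lerNl (le_trans _ (cF x))//.
  by rewrite -normrN ler_norm.
Qed.

End Duality.

Unset Implicit Arguments.

Theorem mainTheorem7 (R : realType) (n k : nat)
  (X : 'I_n -> ptopologicalType)
  (Xpolish : forall i : 'I_n, polish R (X i))
  (k_ge1 : (1 <= k)%N) (k_ltn : (k < n)%N)
  (mu : forall a : Ink n k, probability (borel (Xsub X (val a))) R) :
  (forall c : Xfull X -> R, CL_full mu c ->
     primal_value mu c = dual_value mu (fun a => CL (mu a)) c /\
     ((exists pi, Pi_marg mu pi) ->
        exists2 pi, Pi_marg mu pi &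
          (\int[pi]_(x in setT) (c x)%:E)%E = primal_value mu c)) /\
  (forall c : Xfull X -> R, Cb c ->
     primal_value mu c = dual_value mu (fun a => @Cb R (Xsub X (val a))) c /\
     ((exists pi, Pi_marg mu pi) ->
        exists2 pi, Pi_marg mu pi &
          (\int[pi]_(x in setT) (c x)%:E)%E = primal_value mu c)).
Proof.
have Cb_CL (a : Ink n k) f : @Cb R (Xsub X (val a)) f -> CL (mu a) f.
  by move=> Cf; split; [exact: Cf.1|exact: Cb_integrable].
split=> c.
  move=> [cc cdom]; apply: duality_in_class => //.
  - move=> a r f g [cf fi] [cg gi]; split.
      by move=> y; apply: cvgD; [apply: cvgMr; exact: cf|exact: cg].
    have := integrableD measurableT (integrableZl measurableT r fi) gi.
    by congr integrable.
  - move=> a f [cf fi]; split; last exact: integrable_norm.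
    by move=> y; apply: cvg_norm; exact: cf.
(* Here [P] is [Cb] itself; a bounded [c] is dominated by a constant potential, which belongs to
   that class. *)
move=> Cc.
have Cb_lin' (a : Ink n k) r (f g : Xsub X (val a) -> R) : Cb f -> Cb g ->
  Cb (fun y => r * f y + g y) by exact: Cb_lin.
apply: duality_in_class => //.
- move=> a f [cf [M fM]]; split; last by exists M => y; rewrite normr_id.
  by move=> y; apply: cvg_norm; exact: cf.
- exact: Cc.1.
- exact: Cb_dominated.
Qed.
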